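(* Let $\Lambda_0$ be an ordered abelian group and put $\Lambda=\mathbb{Z}\times\Lambda_0$. Suppose that the following are given. (S1) A graph of groups $(\mathcal{G},Y^*,T^* )$ with Bass–Serre tree $X^*$, vertex groups $\mathcal{G}(x^* )$ ($x^*\in Y^*$), edge groups $\mathcal{G}(e)$ and edge group embeddings $\alpha_e:\mathcal{G}(e)\to\mathcal{G}(\partial_0^{Y^*}e)$ ($e\in E(Y^* )$), and $T_0^*\subseteq S^*\subseteq X^*$, where $T_0^*$ is a tree of vertex representatives isomorphic to $T^*$ and $S^*$ is a tree of edge representatives. Thus $\pi_1(\mathcal{G})$ has the presentation with generators the groups $\mathcal{G}(x^* )$ ($x^*\in Y^*$) and elements $g_e$ ($e\in E(Y^* )$), and relations (besides those of the $\mathcal G(x^* )$) $g_e\alpha_e(s)g_e^{-1}=g_{\bar e}\alpha_{\bar e}(s)g_{\bar e}^{-1}$ ($e\in E(Y^* )$, $s\in\mathcal{G}(e)$) and $g_e=1$ whenever $\partial_0^{X^*}e\in T_0^*$, where the $g_e$ satisfy $g_e^{-1}\partial_0^{X^*}e\in T_0^*$ for $e\in E(S^* )$. (S2) Elements $\theta_{g_e}\in\mathrm{Aut}^+(\Lambda_0)$ and $\mu_{g_e}\in\Lambda_0$ ($e\in E(Y^* )$), homomorphisms $\theta^{x^*}:\mathcal{G}(x^* )\to\mathrm{Aut}^+(\Lambda_0)$ and functions $\mu^{x^*}:\mathcal{G}(x^* )\to\Lambda_0$ ($x^*\in Y^*$). (S3) $\Lambda_0$-trees $X(x^* )$ for $x^*\in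 Y^*$. (S4) $\theta^{x^*}$-affine actions of $\mathcal{G}(x^* )$ on $X(x^* )$ ($x^*\in Y^*$). (S5) Ends $\epsilon_e$ of $X(\partial_0^{Y^*}e)$ and end maps $\delta_e:X(\partial_0^{Y^*}e)\to\Lambda_0$ towards $\epsilon_e$ ($e\in E(Y^* )$). Write $\theta_{\alpha_e(s)}=\theta^{\partial_0^{Y^*}e}_{\alpha_e(s)}$, $\mu_{\alpha_e(s)}=\mu^{\partial_0^{Y^*}e}_{\alpha_e(s)}$, and similarly for $\bar e$. Assume that (C1) $\epsilon_e$ is of full $\Lambda_0$-type and $\alpha_e\mathcal{G}(e)=(\mathcal{G}(\partial_0^{Y^*}e))_{\epsilon_e}$ ($e\in E(Y^* )$); (C2) if $\partial_0^{Y^*}e=x^*=\partial_0^{Y^*}f$ with $e\neq f$ then $\epsilon_e$ and $\epsilon_f$ lie in distinct $\mathcal{G}(x^* )$-orbits; (C3) $\theta_{g_e}\theta_{\alpha_e(s)}\theta_{g_e}^{-1}=\theta_{g_{\bar e}}\theta_{\alpha_{\bar e}(s)}\theta_{g_{\bar e}}^{-1}$ for $e\in E(Y^* )$, $s\in\mathcal{G}(e)$, and $\theta_{g_e}=1$ if $g_e=1$; (C4) $\mu_{g_e}+\theta_{g_e}\mu_{\alpha_e(s)}-\theta_{g_e}\theta_{\alpha_e(s)}\theta_{g_e}^{-1}\mu_{g_e}=\mu_{\alpha_{|e|}(s)}$ for $e\in E(Y^* )$, $s\in\mathcal{G}(e)$; also $\mu_{gh}=\mu_g+\theta_g\mu_h$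 for $g,h\in\mathcal{G}(x^* )$, $x^*\in Y^*$, and $\mu_{g_e}=0$ if $g_e=1$; (C5) $\theta_{g_e}\left[\theta_{\alpha_e(s)}\delta_e(x)-\delta_e(\alpha_e(s)x)\right]+\theta_{g_{\bar e}}\left[\theta_{\alpha_{\bar e}(s)}\delta_{\bar e}(y)-\delta_{\bar e}(\alpha_{\bar e}(s)y)\right]=\mu_{\alpha_{|e|}(s)}$ for all $x\in X(\partial_0^{Y^*}e)$, $y\in X(\partial_0^{Y^*}\bar e)$, $s\in\mathcal{G}(e)$, $e\in E(Y^* )$. Then there exist (A1) a group $\Gamma$; (A2) a homomorphism $\beta:\Gamma\to\mathrm{Aut}^+(\Lambda)$, $g\mapsto\beta_g$, with $\beta_g(1,\lambda_0)=(1,\theta_g\lambda_0+\mu_g)$; (A3) a $\Lambda$-tree $X$; (A4) a $\beta$-affine action of $\Gamma$ on $X$ with the given data (S1)–(S5) as its signature (in the sense of the context).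
   Context: Ordered abelian groups are linearly ordered; products are lexicographically ordered, first coordinate dominant; $\mathrm{Aut}^+$ denotes the group of order-preserving group automorphisms. A formula $\beta_g(1,\lambda_0)=(1,\theta_g\lambda_0+\mu_g)$ determines $\beta_g\in\mathrm{Aut}^+(\mathbb{Z}\times\Lambda_0)$: $\beta_g(m,\lambda_0)=(m,\theta_g\lambda_0+m\mu_g)$. Trees. A $\Lambda$-metric space is a set with a $\Lambda$-valued function $d$ satisfying the metric axioms; a segment is an isometric image of an interval $[a,b]_\Lambda$; a $\Lambda$-tree is a $\Lambda$-metric space in which any two points are endpoints of a segment, two segments with a common endpoint meet in a segment, and two segments meeting in exactly one point, an endpoint of both, have union a segment. An action is $\beta$-affine if $d(gx,gy)=\beta_gd(x,y)$ for all $g,x,y$. Ends. An $X$-ray from $x$ is a linear subtree with $x$ as an endpoint, maximal among such; two rays are equivalent if their intersection is a ray from some point; ends are equivalence classes; $[x,\epsilon)$ is the ray from $x$ in the class $\epsilon$. An end $\epsilon$ of a $\Lambda_0$-tree is of full $\Lambda_0$-type if $\{d(x,y):y\in[x,\epsilon)\}=[0,\infty)_{\Lambda_0}$. An end map towards $\epsilon$ is a function $\delta$ to $\Lambda_0$ with $\delta(y)-\delta(x)=d(x,y)$ whenever $y\in[x,\epsilon)$. $G_\epsilon$ denotes the stabiliser of $\epsilon$ in $G$. The tree $X^*$ of a $\Lambda$-tree. For $\Lambda=\mathbb{Z}\times\Lambda_0$ and a $\Lambda$-tree $X$, $\mathbb{Z}\otimes_\Lambda X$ is the quotient of $X$ identifying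 points whose distance lies in $0\times\Lambda_0$; it is a $\mathbb{Z}$-tree, viewed as an ordinary (simplicial) tree. The fibre $X(x^* )$ over $x^*$ is a $\Lambda_0$-tree with metric $d_{x^*}$ given by $d(x,y)=(0,d_{x^*}(x,y))$. Graphs. $E(Y)$ is the set of oriented edges of a graph $Y$; $\bar e$ is the reverse of $e$ and $\partial_0e$ the origin of $e$; $Y$ also denotes the vertex set. If a group acts on a tree $X^*$ without inversions with quotient $Y^*$, a tree of vertex representatives is a subtree $T_0^*\subseteq X^*$ mapping isomorphically onto a maximal subtree $T^*$ of $Y^*$; a tree of edge representatives is a subtree $S^*\supseteq T_0^*$ such that $E(S^* )\to E(Y^* )$ is a bijection (each edge of $S^*$ has at least one endpoint in $T_0^*$). Vertices of $Y^*$ are identified with those of $T_0^*$, and $E(Y^* )$ with $E(S^* )$; $\partial_0^{X^*}e$ is the origin in $X^*$ of $e\in E(S^* )$, and $\partial_0^{Y^*}e$ its origin in $Y^*$ (identified with a vertex of $T_0^*$). If $\partial_0^{X^*}e\in T_0^*$ and $\partial_0^{X^*}\bar e\notin T_0^*$ put $|e|=|\bar e|=e$; if both lie in $T_0^*$, $|e|=|\bar e|$ denotes a fixed choice of one of $e,\bar e$ (then $\alpha_e(s)$ and $\alpha_{\bar e}(s)$ are identified in $\pi_1(\mathcal{G})$). Signature of an action. Suppose $\Gamma$ acts $\beta$-affinely on a $\Lambda$-tree $X$, with induced action on $\mathbb{Z}\otimes_\Lambda X$ without inversions. The given data (S1)–(S5) are the signature of this action if, after identifying $\Gamma$ with $\pi_1(\mathcal{G})$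 and $\mathbb{Z}\otimes_\Lambda X$ equivariantly with $X^*$: $\mathcal{G}(x^* )=\Gamma_{x^*}$ for $x^*\in T_0^*$, $\mathcal{G}(e)=\Gamma_e$ for $e\in E(S^* )$ and $\alpha_e(s)=g_e^{-1}sg_e$; $\theta^{x^*},\mu^{x^*}$ are the restrictions to $\mathcal{G}(x^* )$ of $g\mapsto\theta_g$, $g\mapsto\mu_g$ (from $\beta_g(1,\lambda_0)=(1,\theta_g\lambda_0+\mu_g)$), and $\theta_{g_e},\mu_{g_e}$ are the values of these at $g_e$; for $x^*\in T_0^*$ the given tree $X(x^* )$ with its $\mathcal{G}(x^* )$-action is the fibre over $x^*$ with metric $d_{x^*}$ and the restricted action; for $e\in E(S^* )$, $\epsilon_e=g_e^{-1}\epsilon_e^{X^*}$, where $\epsilon_e^{X^*}$ is the end of the fibre $X(\partial_0^{X^*}e)$ with $[x,y]\cap X(\partial_0^{X^*}e)=[x,\epsilon_e^{X^*})$ for $x\in X(\partial_0^{X^*}e)$, $y\in X(\partial_0^{X^*}\bar e)$; and $d(x,y)=\bigl(1,-\theta_{g_e}\delta_e(g_e^{-1}x)-\theta_{g_{\bar e}}\delta_{\bar e}(g_{\bar e}^{-1}y)\bigr)$ for all such $e,x,y$. *)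

(* Defs.v *)
From HB Require Import structures.
From mathcomp Require Import all_boot all_order all_algebra.
From mathcomp Require Import boolp classical_sets.

Set Implicit Arguments.
Unset Strict Implicit.
Unset Printing Implicit Defensive.

Import Order.TTheory GRing.Theory Num.Theory.

Local Open Scope classical_set_scope.
Local Open Scope ring_scope.

(** Totality is an axiom of the mixin, since inheriting from [Order.Total] would
    require a join with [GRing.Zmodule] that is missing below [RealDomain]. *)
HB.mixin Record isOrderedAbGroup L of Num.POrderedZmodule L := {
  oag_total : total (<=%O : rel L);
  oag_leD2l : forall z x y : L, x <= y -> z + x <= z + y
}.

#[short(type="oagType")]
HB.structure Definition OrderedAbGroup :=
  { L of isOrderedAbGroup L & Num.POrderedZmodule L }.

Definition oabs (L : oagType) (x : L) : L := Order.max x (- x).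

(** [lexZ L0] is the group Z x L0, ordered lexicographically with the first
    coordinate dominant. *)
Definition lexZ (L0 : oagType) : Type := (int *lexi[ring_display] L0)%type.

HB.instance Definition _ (L0 : oagType) :=
  Order.POrder.copy (lexZ L0) (int *lexi[ring_display] L0)%type.
HB.instance Definition _ (L0 : oagType) :=
  GRing.Zmodule.copy (lexZ L0) (int * L0)%type.

Lemma lexZ_le (L0 : oagType) (x y : lexZ L0) :
  (x <= y) = (x.1 < y.1) || ((x.1 == y.1) && (x.2 <= y.2)).
Proof. by rewrite Order.ProdLexiOrder.leEprodlexi; case: ltgtP. Qed.

Fact lexZ_leD2l (L0 : oagType) (z x y : lexZ L0) : x <= y -> z + x <= z + y.
Proof.
rewrite !lexZ_le => /orP[h|/andP[/eqP h1 h2]]; apply/orP.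
  by left; rewrite /= ltrD2l.
by right; rewrite /= h1 eqxx oag_leD2l.
Qed.

Fact lexZ_total (L0 : oagType) : total (<=%O : rel (lexZ L0)).
Proof. by move=> x y; rewrite !lexZ_le; case: ltgtP => //= _; exact: oag_total. Qed.

HB.instance Definition _ (L0 : oagType) :=
  isOrderedAbGroup.Build (lexZ L0) (@lexZ_total L0) (@lexZ_leD2l L0).

(** The group Aut^+(L); the inverse is carried along as a field, but it is
    determined by the automorphism. *)
Record autp (L : oagType) := Autp {
  autp_fun :> L -> L;
  autp_inv : L -> L;
  autpD : {morph autp_fun : x y / x + y};
  autp_le : {homo autp_fun : x y / x <= y};
  autp_funK : cancel autp_fun autp_inv;
  autp_invK : cancel autp_inv autp_fun
}.

Section AutpGroup.
Variable L : oagType.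
Implicit Types f g h : autp L.

Lemma autpP f g : (forall x, f x = g x) -> f = g.
Proof.
case: f g => [f f' fD fl fK f'K] [g g' gD gl gK g'K] /= /funext fg.
case: _ / fg gD gl gK g'K => gD gl gK g'K.
have e : f' = g' by apply/funext => x; rewrite -[x in LHS]g'K fK.
case: _ / e gK g'K => gK g'K.
by rewrite (Prop_irrelevance gD fD) (Prop_irrelevance gl fl)
  (Prop_irrelevance gK fK) (Prop_irrelevance g'K f'K).
Qed.

HB.instance Definition _ := gen_eqMixin (autp L).
HB.instance Definition _ := gen_choiceMixin (autp L).

Definition autp_one : autp L :=
  @Autp L id id (fun _ _ => erefl) (fun _ _ => id) (fun _ => erefl)
    (fun _ => erefl).

Definition autp_mul f g : autp L.
Proof.
apply: (@Autp L (f \o g) (autp_inv g \o autp_inv f)).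
- by move=> x y /=; rewrite !autpD.
- by move=> x y xy /=; do 2 apply: autp_le.
- by move=> x /=; rewrite !autp_funK.
- by move=> x /=; rewrite !autp_invK.
Defined.

Definition autp_opp f : autp L.
Proof.
apply: (@Autp L (autp_inv f) f); last 2 first.
- exact: autp_invK.
- exact: autp_funK.
- by move=> x y; apply: (can_inj (autp_funK f)); rewrite autpD !autp_invK.
- move=> x y xy; case/orP: (oag_total (autp_inv f x) (autp_inv f y)) => // h.
  have := autp_le f h; rewrite !autp_invK => yx.
  by rewrite (@le_anti _ _ x y) // xy yx.
Defined.

Fact autp_mulA : associative autp_mul. Proof. by move=> f g h; exact: autpP. Qed.
Fact autp_mul1 : left_id autp_one autp_mul. Proof. by move=> f; exact: autpP. Qed.
Fact autp_mulr1 : right_id autp_one autp_mul. Proof. by move=> f; exact: autpP. Qed.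
Fact autp_mulV : left_inverse autp_one autp_opp autp_mul.
Proof. by move=> f; apply: autpP => x /=; rewrite autp_funK. Qed.
Fact autp_mulrV : right_inverse autp_one autp_opp autp_mul.
Proof. by move=> f; apply: autpP => x /=; rewrite autp_invK. Qed.

HB.instance Definition _ := isGroup.Build (autp L)
  autp_mulA autp_mul1 autp_mulr1 autp_mulV autp_mulrV.

End AutpGroup.

Record lmetric (L : oagType) := LMetric {
  lm_sort :> Type;
  dist : lm_sort -> lm_sort -> L;
  dist_ge0 : forall x y, 0 <= dist x y;
  dist_eq0 : forall x y, dist x y = 0 <-> x = y;
  distC : forall x y, dist x y = dist y x;
  dist_triangle : forall x y z, dist x z <= dist x y + dist y z
}.

Section Trees.
Variables (L : oagType) (X : lmetric L).
Implicit Types (x y z w : X) (A B S : set X).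

Definition segment_between x y S := exists (a b : L) (f : L -> X),
  [/\ a <= b,
      forall s t : L, a <= s <= b -> a <= t <= b ->
        dist (f s) (f t) = oabs (s - t),
      f a = x, f b = y & S = f @` [set t | a <= t <= b]].

Definition is_segment S := exists x y, segment_between x y S.

(** In an L-tree, [in_seg x y] is the unique segment [x, y]. *)
Definition in_seg x y : set X :=
  [set z | exists2 S, segment_between x y S & S z].

(** L-trees are taken to be nonempty. *)
Definition is_ltree : Prop := [/\ inhabited X,
  forall x y, exists S, segment_between x y S,
  forall x y z S S', segment_between x y S -> segment_between x z S' ->
    is_segment (S `&` S') &
  forall x y z S S', segment_between x y S -> segment_between x z S' ->
    S `&` S' = [set x] -> is_segment (S `|` S')].

Definition is_subtree A :=
  A !=set0 /\ forall x y, A x -> A y -> in_seg x y `<=` A.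

Definition is_linear A := exists f : X -> L,
  forall x y, A x -> A y -> dist x y = oabs (f x - f y).

Definition is_endpoint x A := A x /\
  forall y z, A y -> A z -> dist y x + dist x z = dist y z -> y = x \/ z = x.

Definition linear_from x A := [/\ is_subtree A, is_linear A & is_endpoint x A].

(** [is_ray x A]: [A] is an X-ray from [x]. *)
Definition is_ray x A := linear_from x A /\
  forall B, linear_from x B -> A `<=` B -> B `<=` A.

(** Equivalence of the ray [A] from [x] and the ray [B] from [y]: [A `&` B] is
    a ray from some [w], and it lies beyond [w] as seen from [x] and from [y].
    Without the last condition, two rays to different ends whose common origin
    [x] is a leaf, branching at [w], would be equivalent: they meet in the
    segment [x, w], which is a ray from [w], but towards [x]. *)
Definition ray_equiv x A y B := exists w, is_ray w (A `&` B) /\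
  forall z, (A `&` B) z ->
    dist x w + dist w z = dist x z /\ dist y w + dist w z = dist y z.

(** An end is a class of pairs (origin, ray); [eps x A] says that
    [A = [x, eps)]. *)
Definition ray_class := X -> set X -> Prop.

Definition is_end (eps : ray_class) := exists x0 A0, is_ray x0 A0 /\
  forall x A, eps x A <-> is_ray x A /\ ray_equiv x0 A0 x A.

(** The ray [x, eps). *)
Definition ray_to x (eps : ray_class) : set X := \bigcup_(A in eps x) A.

Definition full_type (eps : ray_class) :=
  forall x, dist x @` ray_to x eps = [set l | 0 <= l].

Definition end_map (eps : ray_class) (delta : X -> L) :=
  forall x y, ray_to x eps y -> delta y - delta x = dist x y.

End Trees.

Definition class_image (L1 L2 : oagType) (X : lmetric L1) (Y : lmetric L2)
    (h : X -> Y) (eps : ray_class X) : ray_class Y :=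
  fun y B => exists x A, [/\ eps x A, y = h x & B = h @` A].

Definition is_action (G : groupType) (X : Type) (act : G -> X -> X) :=
  (forall x, act 1%g x = x) /\
  (forall g h x, act (g * h)%g x = act g (act h x)).

Definition is_affine (L : oagType) (X : lmetric L) (G : groupType)
    (beta : G -> autp L) (act : G -> X -> X) :=
  forall g x y, dist (act g x) (act g y) = beta g (dist x y).

Record graph := Graph {
  vert : Type;
  edge : Type;
  orig : edge -> vert;
  rev : edge -> edge;
  revK : involutive rev;
  rev_neq : forall e, rev e <> e
}.

Section Graphs.
Variable Y : graph.

Fixpoint walk (x : vert Y) (p : seq (edge Y)) (y : vert Y) : Prop :=
  if p is e :: p' then orig e = x /\ walk (orig (rev e)) p' y else x = y.

Fixpoint reduced (p : seq (edge Y)) : Prop :=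
  if p is e :: p' then
    (if p' is f :: _ then f <> rev e else True) /\ reduced p'
  else True.

Fixpoint edges_in (E : set (edge Y)) (p : seq (edge Y)) : Prop :=
  if p is e :: p' then E e /\ edges_in E p' else True.

Record subgraph := Subgraph {
  sgv : set (vert Y);
  sge : set (edge Y);
  sg_rev : forall e, sge e -> sge (rev e);
  sg_orig : forall e, sge e -> sgv (orig e)
}.

Definition full_subgraph : subgraph :=
  @Subgraph setT setT (fun _ => id) (fun _ => id).

Definition sub_subgraph (S T : subgraph) :=
  sgv S `<=` sgv T /\ sge S `<=` sge T.

Definition graph_connected :=
  inhabited (vert Y) /\ forall x y, exists p, walk x p y.

Definition is_tree (T : subgraph) := sgv T !=set0 /\
  forall x y, sgv T x -> sgv T y ->
    exists! p, [/\ walk x p y, reduced p & edges_in (sge T) p].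

Definition is_maximal_subtree (T : subgraph) := is_tree T /\
  forall S, is_tree S -> sub_subgraph T S -> sub_subgraph S T.

End Graphs.

(** The graph with geometric edges [P], in which [(p, true)] and [(p, false)]
    are the two orientations of [p]. Every graph is of this form after a choice
    of an orientation. *)
Definition or_rev (P : Type) (e : P * bool) : P * bool := (e.1, ~~ e.2).

Fact or_revK (P : Type) : involutive (@or_rev P).
Proof. by case=> p b; rewrite /or_rev /= negbK. Qed.

Fact or_rev_neq (P : Type) (e : P * bool) : or_rev e <> e.
Proof. by case: e => p []. Qed.

Definition oriented_graph (V P : Type) (o : P * bool -> V) : graph :=
  @Graph V (P * bool)%type o (@or_rev P) (@or_revK P) (@or_rev_neq P).

Record graph_iso (Y Z : graph) := GraphIso {
  iso_v :> vert Y -> vert Z;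
  iso_e : edge Y -> edge Z;
  iso_v_bij : bijective iso_v;
  iso_e_bij : bijective iso_e;
  iso_orig : forall e, iso_v (orig e) = orig (iso_e e);
  iso_rev : forall e, iso_e (rev e) = rev (iso_e e)
}.

Section ZTensor.
Variables (L0 : oagType) (X : lmetric (lexZ L0)).
Implicit Types x y z : X.

Definition zclass x : set X := [set y | (dist x y).1 = 0].

Definition ztensor : Type := {C : set X | exists x, C = zclass x}.

Definition zpt x : ztensor := exist _ (zclass x) (ex_intro _ x erefl).

Lemma dist1_ge0 x y : 0 <= (dist x y).1.
Proof.
have := dist_ge0 x y; rewrite lexZ_le /=.
by case/orP => [/ltW//|/andP[/eqP <-]].
Qed.

Lemma dist1_triangle x y z : (dist x z).1 <= (dist x y).1 + (dist y z).1.
Proof.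
have := dist_triangle x y z; rewrite lexZ_le /=.
by case/orP => [/ltW//|/andP[/eqP <-]].
Qed.

Lemma dist1xx x : (dist x x).1 = 0.
Proof. by have [_ ->] := dist_eq0 x x. Qed.

Lemma zptP x y : zpt x = zpt y <-> (dist x y).1 = 0.
Proof.
split=> [e | xy].
  have : sval (zpt x) y by rewrite e; exact: dist1xx.
  by [].
suff e : zclass x = zclass y by exact: eq_exist.
apply/funext => z; apply/propext; rewrite /zclass /=.
have yx : (dist y x).1 = 0 by rewrite distC.
split=> h; apply: le_anti; rewrite dist1_ge0 andbT.
  by have := dist1_triangle y x z; rewrite yx h.
by have := dist1_triangle x y z; rewrite xy h.
Qed.

(** Z (x)_L X as a graph: an oriented edge is an ordered pair of points at
    distance 1 in the Z-metric induced by [dist]. *)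
Definition zadj (C D : ztensor) :=
  exists x y, [/\ zpt x = C, zpt y = D & (dist x y).1 = 1].

Definition zedge : Type := {CD : ztensor * ztensor | zadj CD.1 CD.2}.

Definition zorig (e : zedge) : ztensor := (sval e).1.

Fact zadjC C D : zadj C D -> zadj D C.
Proof. by case=> x [y [xC yD xy]]; exists y, x; rewrite distC. Qed.

Definition zrev (e : zedge) : zedge :=
  exist _ ((sval e).2, (sval e).1) (zadjC (svalP e)).

Fact zrevK : involutive zrev.
Proof. by case=> [[C D] h]; exact: eq_exist. Qed.

Fact zrev_neq e : zrev e <> e.
Proof.
case: e => [[C D] [x [y [/= xC yD xy]]]] /(congr1 (fun e => (sval e).1)) /= DC.
have /zptP : zpt x = zpt y by rewrite xC yD.
by rewrite xy.
Qed.

Definition ztree : graph := Graph zorig zrevK zrev_neq.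

(** The fibre over a point of Z (x)_L X, with its L0-valued metric. *)
Section Fibre.
Variable C : ztensor.

Definition fibre_pt : Type := {x : X | zpt x = C}.

Definition fibre_dist (p q : fibre_pt) : L0 := (dist (sval p) (sval q)).2.

Lemma fibre_dist1 (p q : fibre_pt) : (dist (sval p) (sval q)).1 = 0.
Proof. by apply/zptP; rewrite (svalP p) (svalP q). Qed.

Lemma fibre_distE (p q : fibre_pt) :
  dist (sval p) (sval q) = (0, fibre_dist p q) :> lexZ L0.
Proof. by rewrite [LHS]surjective_pairing fibre_dist1. Qed.

Fact fibre_dist_ge0 p q : 0 <= fibre_dist p q.
Proof.
have := dist_ge0 (sval p) (sval q).
by rewrite fibre_distE lexZ_le.
Qed.

Fact fibre_dist_eq0 p q : fibre_dist p q = 0 <-> p = q.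
Proof.
split=> [h|->].
  case: p q h => [p hp] [q hq] h; apply: eq_exist.
  by apply/dist_eq0; have := fibre_distE (exist _ p hp) (exist _ q hq); rewrite h.
by rewrite /fibre_dist; have [_ ->] := dist_eq0 (sval q) (sval q).
Qed.

Fact fibre_distC p q : fibre_dist p q = fibre_dist q p.
Proof. by rewrite /fibre_dist distC. Qed.

Fact fibre_dist_triangle p q r :
  fibre_dist p r <= fibre_dist p q + fibre_dist q r.
Proof.
have := dist_triangle (sval p) (sval q) (sval r).
by rewrite !fibre_distE lexZ_le.
Qed.

Definition fibre : lmetric L0 := LMetric
  fibre_dist_ge0 fibre_dist_eq0 fibre_distC fibre_dist_triangle.

Definition fibre_val (p : fibre) : X := sval p.

End Fibre.

(** The setwise stabiliser of a fibre, i.e. the stabiliser of the point [C] for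
    the induced action on Z (x)_L X. *)
Definition zstab (G : groupType) (act : G -> X -> X) (C : ztensor) : set G :=
  [set g | forall x, zpt x = C -> zpt (act g x) = C].

Definition z_inversion (G : groupType) (act : G -> X -> X) (g : G) :=
  exists x y, [/\ (dist x y).1 = 1, zpt (act g x) = zpt y &
                  zpt (act g y) = zpt x].

End ZTensor.

(** The edge group [EG e.1] only depends on the geometric edge, so that the
    groups of [e] and of [rev e] are the same on the nose. *)
Record graph_of_groups := GraphOfGroups {
  gg_vert : Type;
  gg_gedge : Type;
  gg_orig : gg_gedge * bool -> gg_vert;
  gg_graph := oriented_graph gg_orig;
  VG : gg_vert -> groupType;
  EG : gg_gedge -> groupType;
  alpha : forall e : gg_gedge * bool,
    {multiplicative (EG e.1) -> (VG (gg_orig e))};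
  alpha_inj : forall e, injective (alpha e);
  gg_connected : graph_connected gg_graph;
  gg_tree : subgraph gg_graph;
  gg_tree_max : is_maximal_subtree gg_tree
}.

Section BassSerre.
Variable GG : graph_of_groups.
Let Y := gg_graph GG.

(** The two families of relations of the presentation of the fundamental group,
    for the images [f x] of the vertex groups and [h e] of the generators g_e in
    a group [H]; [E1] is the set of edges whose generator is killed. *)
Definition pi1_relations (E1 : set (edge Y)) (H : groupType)
    (f : forall x : vert Y, {multiplicative (VG x) -> H})
    (h : edge Y -> H) : Prop :=
  (forall (e : edge Y) (s : EG e.1),
     (h e * f (orig e) (alpha e s) * (h e)^-1 =
      h (rev e) * f (orig (rev e)) (alpha (rev e) s) * (h (rev e))^-1)%g) /\
  (forall e, E1 e -> h e = 1%g).

(** A Bass-Serre tree X* of [GG]: the tree with an action without inversions of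
    the fundamental group [pi1] whose quotient graph is Y* and whose vertex and
    edge groups, read off along T0* and S*, are the given ones, with
    [alpha e s] equal to s conjugated by g_e. The vertices of T0* are the
    [liftv x] and the oriented edges of S* are the [lifte e]; the elements g_e
    are the [gE e], and |e| is [(e.1, abs_or e.1)]. *)
Record bass_serre := BassSerre {
  bsX : graph;
  bs_is_tree : is_tree (full_subgraph bsX);
  pi1 : groupType;
  actv : pi1 -> vert bsX -> vert bsX;
  acte : pi1 -> edge bsX -> edge bsX;
  actv_action : is_action actv;
  acte_action : is_action acte;
  act_orig : forall g e, orig (acte g e) = actv g (orig e);
  act_rev : forall g e, rev (acte g e) = acte g (rev e);
  act_noinv : forall g e, acte g e <> rev e;
  quov : vert bsX -> vert Y;
  quoe : edge bsX -> edge Y;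
  quo_orig : forall e, orig (quoe e) = quov (orig e);
  quo_rev : forall e, quoe (rev e) = rev (quoe e);
  quovP : forall v w, quov v = quov w <-> exists g, w = actv g v;
  quoeP : forall e f, quoe e = quoe f <-> exists g, f = acte g e;
  bsT0 : subgraph bsX;
  bsS : subgraph bsX;
  bsT0_tree : is_tree bsT0;
  bsS_tree : is_tree bsS;
  bsT0S : sub_subgraph bsT0 bsS;
  liftv : vert Y -> vert bsX;
  lifte : edge Y -> edge bsX;
  liftvK : forall x, quov (liftv x) = x;
  lifteK : forall e, quoe (lifte e) = e;
  bsT0v : sgv bsT0 = range liftv;
  bsT0e : sge bsT0 = lifte @` sge (gg_tree GG);
  bsSe : sge bsS = range lifte;
  bsS_end : forall e, sge bsS e ->
    sgv bsT0 (orig e) \/ sgv bsT0 (orig (rev e));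
  incl : forall x : vert Y, {multiplicative (VG x) -> pi1};
  incl_inj : forall x, injective (incl x);
  gE : edge Y -> pi1;
  gEP : forall e, actv (gE e)^-1%g (orig (lifte e)) = liftv (orig e);
  stabvP : forall x g, actv g (liftv x) = liftv x <-> range (incl x) g;
  stabeP : forall (e : edge Y) g, acte g (lifte e) = lifte e <->
    exists s : EG e.1,
      g = (gE e * incl (orig e) (alpha e s) * (gE e)^-1)%g;
  (* the presentation of pi1, as a universal property *)
  bs_E1 : set (edge Y) := [set e | sgv bsT0 (orig (lifte e))];
  pi1_rel : pi1_relations bs_E1 incl gE;
  pi1_univ : forall (H : groupType)
      (f : forall x : vert Y, {multiplicative (VG x) -> H})
      (h : edge Y -> H), pi1_relations bs_E1 f h ->
    exists k : {multiplicative pi1 -> H},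
      (forall x s, k (incl x s) = f x s) /\ (forall e, k (gE e) = h e);
  pi1_gen : forall (H : groupType) (k k' : {multiplicative pi1 -> H}),
    (forall x s, k (incl x s) = k' (incl x s)) ->
    (forall e, k (gE e) = k' (gE e)) -> forall g, k g = k' g;
  abs_or : gg_gedge GG -> bool;
  abs_orP : forall p, sgv bsT0 (orig (lifte (p, abs_or p)))
}.

Definition absE (B : bass_serre) (e : edge Y) : edge Y := (e.1, abs_or B e.1).

End BassSerre.

Record sig_data (L0 : oagType) (GG : graph_of_groups) := SigData {
  thE : edge (gg_graph GG) -> autp L0;
  muE : edge (gg_graph GG) -> L0;
  thV : forall x : vert (gg_graph GG), {multiplicative (VG x) -> (autp L0)};
  muV : forall x : vert (gg_graph GG), VG x -> L0;
  trX : vert (gg_graph GG) -> lmetric L0;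
  trX_tree : forall x, is_ltree (trX x);
  trA : forall x : vert (gg_graph GG), VG x -> trX x -> trX x;
  trA_action : forall x, is_action (@trA x);
  trA_affine : forall x, is_affine (thV x) (@trA x);
  eps : forall e : edge (gg_graph GG), ray_class (trX (orig e));
  epsP : forall e, is_end (@eps e);
  dlt : forall e : edge (gg_graph GG), trX (orig e) -> L0;
  dltP : forall e, end_map (@eps e) (@dlt e)
}.

Arguments muV {L0 GG} s x g : rename.
Arguments trA {L0 GG} s x g a : rename.
Arguments eps {L0 GG} s e a A : rename.
Arguments dlt {L0 GG} s e a : rename.
Arguments thE {L0 GG} s e : rename.
Arguments muE {L0 GG} s e : rename.
Arguments thV {L0 GG} s x : rename.
Arguments trX {L0 GG} s x : rename.

Section Conditions.
Variables (L0 : oagType) (GG : graph_of_groups) (B : bass_serre GG).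
Variable D : sig_data L0 GG.
Let Y := gg_graph GG.

Definition th_alpha (e : edge Y) (s : EG e.1) : autp L0 :=
  thV D (orig e) (alpha e s).

Definition mu_alpha (e : edge Y) (s : EG e.1) : L0 :=
  muV D (orig e) (alpha e s).

Arguments th_alpha : clear implicits.
Arguments mu_alpha : clear implicits.

(** [g eps_e], for [g] in the vertex group of the origin of [e]. *)
Definition act_eps (e : edge Y) (g : VG (orig e)) : ray_class (trX D (orig e)) :=
  class_image (trA D (orig e) g) (eps D e).

Definition C1 : Prop := forall e : edge Y,
  full_type (eps D e) /\
  range (alpha e) = [set g : VG (orig e) | act_eps g = eps D e].

(** Stated as an inequality in the disjoint union of the sets of ends of all
    the trees, which covers the condition that [e] and [f] have the same
    origin. *)
Definition C2 : Prop := forall e f : edge Y, e <> f ->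
  forall g : VG (orig e),
    existT (fun x => ray_class (trX D x)) (orig e) (act_eps g) <>
    existT (fun x => ray_class (trX D x)) (orig f) (eps D f).

Definition C3 : Prop :=
  (forall (e : edge Y) (s : EG e.1),
     (thE D e * th_alpha e s * (thE D e)^-1 =
      thE D (rev e) * th_alpha (rev e) s * (thE D (rev e))^-1)%g) /\
  (forall e : edge Y, gE B e = 1%g -> thE D e = 1%g).

Definition C4 : Prop :=
  [/\ forall (e : edge Y) (s : EG e.1),
        muE D e + thE D e (mu_alpha e s)
          - thE D e (th_alpha e s ((thE D e)^-1%g (muE D e)))
        = mu_alpha (absE B e) s,
      forall (x : vert Y) (g h : VG x),
        muV D x (g * h)%g = muV D x g + thV D x g (muV D x h) &
      forall e : edge Y, gE B e = 1%g -> muE D e = 0].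

Definition C5 : Prop := forall (e : edge Y) (s : EG e.1)
    (x : trX D (orig e)) (y : trX D (orig (rev e))),
  thE D e (th_alpha e s (dlt D e x)
             - dlt D e (trA D (orig e) (alpha e s) x)) +
  thE D (rev e) (th_alpha (rev e) s (dlt D (rev e) y)
             - dlt D (rev e) (trA D (orig (rev e)) (alpha (rev e) s) y))
  = mu_alpha (absE B e) s.

Section Signature.
Variables (Gam : groupType) (theta : Gam -> autp L0) (mu : Gam -> L0).
Variables (X : lmetric (lexZ L0)) (act : Gam -> X -> X).

(** [phi] identifies the fundamental group with [Gam], [F] identifies X* with
    Z (x)_L X, and [j x] identifies the given tree [trX D x] with the fibre over the
    vertex x* of T0*. *)
Record signature_via (phi : {multiplicative (pi1 B) -> Gam})
    (F : graph_iso (bsX B) (ztree X))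
    (j : forall x : vert Y, trX D x -> fibre (F (liftv B x))) : Prop := {
  sig_noinv : forall g, ~ z_inversion act g;
  sig_phi_bij : bijective phi;
  sig_F_equiv : forall (g : pi1 B) (v : vert (bsX B)) (p : X),
    zpt p = F v -> zpt (act (phi g) p) = F (actv g v);
  sig_stabv : forall x : vert Y,
    zstab act (F (liftv B x)) = range (phi \o incl B x);
  sig_stabe : forall e : edge Y,
    zstab act (F (orig (lifte B e))) `&` zstab act (F (orig (rev (lifte B e))))
    = range (fun s : EG e.1 =>
        phi (gE B e * incl B (orig e) (alpha e s) * (gE B e)^-1)%g);
  sig_thV : forall (x : vert Y) (g : VG x), theta (phi (incl B x g)) = thV D x g;
  sig_muV : forall (x : vert Y) (g : VG x), mu (phi (incl B x g)) = muV D x g;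
  sig_thE : forall e : edge Y, theta (phi (gE B e)) = thE D e;
  sig_muE : forall e : edge Y, mu (phi (gE B e)) = muE D e;
  sig_j_bij : forall x : vert Y, bijective (j x);
  sig_j_dist : forall (x : vert Y) (a b : trX D x),
    dist (j x a) (j x b) = dist a b;
  sig_j_equiv : forall (x : vert Y) (g : VG x) (a : trX D x),
    fibre_val (j x (trA D x g a)) = act (phi (incl B x g)) (fibre_val (j x a));
  sig_eps : forall e : edge Y,
    exists epsX : ray_class (fibre (F (orig (lifte B e)))),
      [/\ is_end epsX,
          forall (x : fibre (F (orig (lifte B e))))
                 (y : fibre (F (orig (rev (lifte B e))))),
            in_seg (fibre_val x) (fibre_val y)
              `&` range (@fibre_val _ _ (F (orig (lifte B e))))
            = @fibre_val _ _ _ @` ray_to x epsX &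
          class_image (fun a => fibre_val (j (orig e) a)) (eps D e) =
          class_image (fun p => act (phi (gE B e)^-1%g) (fibre_val p)) epsX];
  sig_dist : forall (e : edge Y) (x : fibre (F (orig (lifte B e))))
      (y : fibre (F (orig (rev (lifte B e)))))
      (a : trX D (orig e)) (b : trX D (orig (rev e))),
    fibre_val (j (orig e) a) = act (phi (gE B e)^-1%g) (fibre_val x) ->
    fibre_val (j (orig (rev e)) b)
      = act (phi (gE B (rev e))^-1%g) (fibre_val y) ->
    dist (fibre_val x) (fibre_val y)
    = (1, - thE D e (dlt D e a) - thE D (rev e) (dlt D (rev e) b))
}.

Definition has_signature : Prop := exists phi F j, @signature_via phi F j.

End Signature.

End Conditions.

(* Main.v *)
From Stdlib Require List Eqdep.
Require Import Defs.
From HB Require Import structures.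
From mathcomp Require Import all_boot all_order all_algebra.
From mathcomp Require Import boolp classical_sets zify.

(** Let Gamma be the fundamental group and X* its Bass-Serre tree. A point of X
    is a vertex v of X* together with a point of a copy of the given
    Lambda_0-tree of the orbit of v, rescaled by theta; Gamma acts by
    construction. What has to be found is the metric between different copies,
    and its compatibility with the action.

    The distance. Transporting the ends and end maps along the edges of S*
    attaches to every oriented edge e of X* an end map [edl e] on the tree at its
    origin. The points x and y at the two ends of an edge e get the distance
    (1, - edl e x - edl (rev e) y). Along a longer path one has to add, for each
    tree passed, the length of the line joining the end at which one enters to
    the end at which one leaves. These ends are distinct, by [C2] for edges in
    different orbits and by [C1] for edges in the same orbit ([edge_of_end]), and
    the normalised length of the line is the opposite of the maximum of the sum of
    the two end maps ([horo_dichotomy], [linelen]).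

    Why this gives a tree. A metric space is a tree if and only if it has points at
    all intermediate distances, satisfies the four-point inequality and has
    medians ([ltree_mtree], [mtree_ltree]). For finitely many points of X and a
    vertex v, every point whose vertex is not v can be replaced by a point of the
    tree at v far out towards the end through which it is seen; this shadow
    differs from it by a quantity which cancels in the conditions to be checked
    ([shadow]). Choosing for v a median of the vertices of three of the points, the
    three properties follow from those of the tree at v, except when an edge
    of X* separates two points from two others, and then the four-point
    inequality is decided by the first coordinate ([tdist_4pt], [tdist_geod],
    [tdist_med]).

    Why the action is affine. By [C3] and [C4] the elements
    theta and mu define a homomorphism from Gamma to the semidirect product of
    Lambda_0 by Aut^+(Lambda_0), which acts on Z x Lambda_0 ([pi1_aff],
    [aff_lex]). Condition [C5] makes the distance across an edge of X*
    independent of the element of Gamma which carries the edge to S* ([edl_sum]).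
    So [edl] is equivariant up to constants, and for an element g the constants of
    e and of its reverse add up to - mu g ([edl_equiv]). Hence a path with n edges
    contributes n times mu g, as it does in the action of g on Z x Lambda_0
    ([td_act]).

    Ends are handled through their end maps throughout: for a function with the two
    properties [horo], rays are described by equations between values and
    distances, and [end_horo] and [horo_is_end] translate to and from ends as
    classes of rays. *)

Set Implicit Arguments.
Unset Strict Implicit.
Unset Printing Implicit Defensive.
Import Order.TTheory GRing.Theory Num.Theory.
Local Open Scope classical_set_scope.
Local Open Scope ring_scope.
Local Notation erev := Defs.rev.

(** * Linear arithmetic in ordered abelian groups *)

Section OagOrder.
Variable L : oagType.
Implicit Types x y z : L.

Lemma oag_leD2 x y z t : x <= y -> z <= t -> x + z <= y + t.
Proof.
move=> xy zt; apply: (le_trans (oag_leD2l x _ _ zt)).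
by rewrite ![_ + t]addrC oag_leD2l.
Qed.

Lemma oag_subr_ge0 x y : (0 <= y - x) = (x <= y).
Proof.
apply/idP/idP => h.
  by have := oag_leD2l x _ _ h; rewrite addr0 addrC subrK.
by have := oag_leD2l (- x) _ _ h; rewrite addNr addrC.
Qed.

Lemma oag_subr_gt0 x y : (0 < y - x) = (x < y).
Proof. by rewrite !lt_def oag_subr_ge0 subr_eq0. Qed.

Lemma oag_leNgt x y : (x <= y) = ~~ (y < x).
Proof.
have [/orP[h|h]] := oag_total x y.
  by rewrite h; apply/esym/negP => /(le_lt_trans h); rewrite ltxx.
by rewrite lt_neqAle h andbT negbK eq_le h.
Qed.

Lemma oag_ltNge x y : (x < y) = ~~ (y <= x).
Proof. by rewrite oag_leNgt negbK. Qed.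
End OagOrder.

(** A reflective decision procedure for linear statements. An ordered abelian group
    is torsion-free, so a linear consequence of linear inequalities is, up to a
    positive integer factor, a nonnegative integer combination of them. The
    combination is found by eliminating variables: first by means of the
    equations, then by adding inequalities of opposite signs. *)
Inductive zexpr :=
  | ZVar of nat | ZZero | ZAdd of zexpr & zexpr | ZOpp of zexpr
  | ZMul of zexpr & nat.

Definition linf := seq int.

Fixpoint ladd (c d : linf) : linf :=
  match c, d with
  | a :: c', b :: d' => (a + b) :: ladd c' d'
  | [::], _ => d
  | _, [::] => c
  end.

Definition lscale (k : int) (c : linf) : linf := [seq a * k | a <- c].

Fixpoint znorm (t : zexpr) : linf :=
  match t with
  | ZVar n => ncons n 0 [:: 1]
  | ZZero => [::]
  | ZAdd t u => ladd (znorm t) (znorm u)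
  | ZOpp t => lscale (-1) (znorm t)
  | ZMul t n => lscale n%:Z (znorm t)
  end.

(** A constraint is a linear form required to be nonnegative, or positive when
    the flag is set; the bit sequence records which of the initial inequalities
    were combined to obtain it, so that redundant ones can be discarded. *)
Definition cons_t := (bool * linf * bitseq)%type.

(** Division by the gcd of the coefficients, which keeps them small. *)
Definition lprim (c : linf) : linf :=
  let g := foldr (fun a d => gcdn `|a|%N d) 0%N c in
  if (1 < g)%N then
    let c' := [seq (a %/ g%:Z)%Z | a <- c] in
    if lscale g%:Z c' == c then c' else c
  else c.

Definition subst_eq i (q c : linf) : linf :=
  let a := nth 0 q i in let b := nth 0 c i in
  lprim (if 0 < a then ladd (lscale a c) (lscale (- b) q)
         else ladd (lscale (- a) c) (lscale b q)).

Fixpoint pick_eq i (pre E : seq linf) : option (linf * seq linf) :=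
  if E is q :: E' then
    if nth 0 q i == 0 then pick_eq i (q :: pre) E' else Some (q, pre ++ E')
  else None.

Fixpoint bor (b c : bitseq) : bitseq :=
  match b, c with
  | x :: b', y :: c' => (x || y) :: bor b' c'
  | [::], _ => c
  | _, [::] => b
  end.

Definition fm_step i (I : seq cons_t) : seq cons_t :=
  [seq c <- I | nth 0 c.1.2 i == 0] ++
   [seq (p.1.1 || n.1.1,
         lprim (ladd (lscale (- nth 0 n.1.2 i) p.1.2)
                     (lscale (nth 0 p.1.2 i) n.1.2)),
         bor p.2 n.2)
   | p <- [seq c <- I | 0 < nth 0 c.1.2 i],
     n <- [seq c <- I | nth 0 c.1.2 i < 0]].

(** A constraint that combines more than k+1 of the initial inequalities after k
    eliminations is implied by the others. Discarding it affects only the size of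
    the problem, and soundness is immediate. *)
Fixpoint prune (k : nat) (I : seq cons_t) : seq cons_t :=
  if I is c :: I' then
    let I' := prune k I' in
    if (k.+1 < count id c.2)%N ||
       has (fun d : cons_t =>
              (d.1 == c.1) && (count id d.2 <= count id c.2)%N) I'
    then I'
    else c :: I'
  else [::].

(** The number of constraints created by the elimination of the variable [i]; the
    cheapest variable is eliminated first. *)
Definition fm_cost (I : seq cons_t) i : nat :=
  (count (fun c : cons_t => (0 < nth 0 c.1.2 i)%R) I *
   count (fun c : cons_t => (nth 0 c.1.2 i < 0)%R) I)%N.

Fixpoint best (f : nat -> nat) (i : nat) (v : nat) (s : seq nat) : nat :=
  if s is j :: s' then
    let w := f j in if (w < v)%N then best f j w s' else best f i v s'
  else i.

Fixpoint eliminate (n k : nat) (vars : seq nat) (I : seq cons_t) : bool :=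
  has (fun c : cons_t => c.1.1 && all (fun a => a == 0) c.1.2) I ||
  (if n is n'.+1 then
    if vars is i :: vars' then
      let j := best (fm_cost I) i (fm_cost I i) vars' in
      eliminate n' k.+1 (rem j vars) (prune k.+1 (fm_step j I))
    else false
  else false).

Fixpoint refute (i vars : seq nat) (E : seq linf) (I : seq cons_t) :=
  if i is j :: i' then
    if pick_eq j [::] E is Some (q, E') then
      refute i' vars [seq subst_eq j q c | c <- E']
                     [seq (c.1.1, subst_eq j q c.1.2, c.2) | c <- I]
    else refute i' (j :: vars) E I
  else eliminate (size vars) 0 vars (prune (size I) I).

Section Soundness.
Variables (L : oagType) (env : seq L).

Fixpoint lval (c : linf) (e : seq L) : L :=
  match c, e with
  | a :: c', x :: e' => x *~ a + lval c' e'
  | _, _ => 0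
  end.

Lemma lvalD c d e : lval (ladd c d) e = lval c e + lval d e.
Proof.
elim: c d e => [|a c IH] [|b d] [|x e] //=; rewrite ?addr0 ?add0r //.
by rewrite IH mulrzDr addrACA.
Qed.

Lemma lvalM k c e : lval (lscale k c) e = lval c e *~ k.
Proof.
elim: c e => [|a c IH] [|x e] //=; rewrite ?mul0rz //.
by rewrite IH mulrzDl mulrzA.
Qed.

Fixpoint zeval (t : zexpr) : L :=
  match t with
  | ZVar n => nth 0 env n
  | ZZero => 0
  | ZAdd t u => zeval t + zeval u
  | ZOpp t => - zeval t
  | ZMul t n => zeval t *+ n
  end.

Lemma znormP t : zeval t = lval (znorm t) env.
Proof.
elim: t => /= [n||t -> u ->|t ->|t -> n]; rewrite ?lvalD ?lvalM ?mulrN1z //.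
by elim: n env => [|n IH] [|x e] //=; rewrite ?mulr1z ?addr0 ?mulr0z ?add0r ?IH.
Qed.

Definition cholds (c : cons_t) : Prop :=
  if c.1.1 then 0 < lval c.1.2 env else 0 <= lval c.1.2 env.
Definition eholds (c : linf) : Prop := lval c env = 0.

Lemma oag_mulrn_ge0 (x : L) n : 0 <= x -> 0 <= x *+ n.
Proof.
by move=> x0; elim: n => //= n IH; rewrite mulrSr -[0]addr0 oag_leD2.
Qed.

Lemma oag_mulrz_ge0 (x : L) (a : int) : 0 < a -> 0 <= x -> 0 <= x *~ a.
Proof. by case: a => // n _ x0; exact: oag_mulrn_ge0. Qed.

Lemma oag_mulrz_gt0 (x : L) (a : int) : 0 < a -> 0 < x -> 0 < x *~ a.
Proof.
case: a => // -[//|n] _ x0; rewrite -pmulrn mulrS.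
by apply: (lt_le_trans x0); rewrite -[leLHS]addr0 oag_leD2l ?oag_mulrn_ge0 ?ltW.
Qed.

Lemma lprimP c : exists2 g : int, 0 < g & lval c env = lval (lprim c) env *~ g.
Proof.
rewrite /lprim; case: ifP => [g1|_]; last by exists 1.
case: eqP => [e|_]; last by exists 1.
by exists (foldr (fun a d => gcdn `|a|%N d) 0%N c)%:Z;
  rewrite ?ltz_nat ?(ltnW g1) // -lvalM e.
Qed.

Lemma lprim_ge0 c : 0 <= lval c env -> 0 <= lval (lprim c) env.
Proof.
have [g g0 ->] := lprimP c; rewrite !oag_leNgt; apply: contraNN => h.
have oppP (x : L) : (x < 0) = (0 < - x) by rewrite -[- x]sub0r oag_subr_gt0.
by rewrite oppP -mulNrz oag_mulrz_gt0 // -oppP.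
Qed.

Lemma lprim_gt0 c : 0 < lval c env -> 0 < lval (lprim c) env.
Proof.
have [g g0 e] := lprimP c => h.
rewrite lt_def lprim_ge0 ?ltW // andbT; apply/negP => /eqP e0.
by move: h; rewrite e e0 mul0rz ltxx.
Qed.

Lemma lprim_eq0 c : lval c env = 0 -> lval (lprim c) env = 0.
Proof.
move=> e; apply: le_anti; rewrite lprim_ge0 ?e // andbT oag_leNgt.
have [g g0] := lprimP c; rewrite e => e'; apply/negP => /(oag_mulrz_gt0 g0).
by rewrite -e' ltxx.
Qed.

Lemma subst_eqP i q (c : cons_t) : nth 0 q i != 0 -> eholds q ->
  cholds c -> cholds (c.1.1, subst_eq i q c.1.2, c.2).
Proof.
rewrite /cholds /eholds /subst_eq /= => qi q0 hc.
have h a b : 0 < a ->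
    if c.1.1 then 0 < lval (lprim (ladd (lscale a c.1.2) (lscale b q))) env
    else 0 <= lval (lprim (ladd (lscale a c.1.2) (lscale b q))) env.
  move=> a0; case: c.1.1 hc => hc; [apply: lprim_gt0|apply: lprim_ge0];
    rewrite lvalD !lvalM q0 mul0rz addr0; [exact: oag_mulrz_gt0|].
  exact: oag_mulrz_ge0.
case: (boolP (0 < nth 0 q i)) => a0; apply: h => //.
by rewrite oppr_gt0 lt_neqAle qi /= leNgt a0.
Qed.

Lemma subst_eqE i q c : eholds q -> eholds c -> eholds (subst_eq i q c).
Proof.
rewrite /eholds /subst_eq => q0 c0.
by apply: lprim_eq0; case: ifP => _; rewrite lvalD !lvalM q0 c0 !mul0rz addr0.
Qed.

Lemma pick_eqP i pre E q E' : pick_eq i pre E = Some (q, E') ->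
  [/\ nth 0 q i != 0, q \in pre ++ E & {subset E' <= pre ++ E}].
Proof.
elim: E pre => //= p E IH pre.
have sh x : (x \in pre ++ p :: E) = (x \in (p :: pre) ++ E).
  by rewrite !(mem_cat, inE) orbCA orbA.
case: ifPn => [pi /IH[qi qE sE]|pi [<- <-]].
  by split=> // [|x /sE]; rewrite sh.
split=> //; first by rewrite mem_cat inE eqxx orbT.
by move=> x; rewrite !mem_cat inE => /orP[->|->]; rewrite ?orbT.
Qed.

Definition all_hold (I : seq cons_t) := forall c, c \in I -> cholds c.

Lemma fm_stepP i I : all_hold I -> all_hold (fm_step i I).
Proof.
move=> hI c; rewrite mem_cat => /orP[|].
  by rewrite mem_filter => /andP[_ /hI].
case/allpairsP=> -[[[bp p] rp] [[bn n] rn]] /= [].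
rewrite !mem_filter /= => /andP[p0 /hI hp] /andP[n0 /hI hn] ->.
move: hp hn; rewrite /cholds /= => hp hn.
have n0' : 0 < - nth 0 n i by rewrite oppr_gt0.
have dlt (x y : L) : 0 < x -> 0 <= y -> 0 < x + y.
  by move=> x0 y0; apply: (lt_le_trans x0); rewrite -[leLHS]addr0 oag_leD2l.
case: bp hp => hp; case: bn hn => hn /=;
  [apply: lprim_gt0|apply: lprim_gt0|apply: lprim_gt0|apply: lprim_ge0];
  rewrite lvalD !lvalM.
- by apply: dlt; [exact: oag_mulrz_gt0|apply/ltW/oag_mulrz_gt0].
- by apply: dlt; [exact: oag_mulrz_gt0|apply: oag_mulrz_ge0].
- by rewrite addrC; apply: dlt; [exact: oag_mulrz_gt0|apply: oag_mulrz_ge0].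
- by rewrite -[0]addr0 oag_leD2 // oag_mulrz_ge0.
Qed.

Lemma prune_sub k I : {subset prune k I <= I}.
Proof.
elim: I => //= c I IH d; case: ifP => _.
  by rewrite inE => /IH->; rewrite orbT.
rewrite !inE => /orP[]; first by move->.
by move/IH->; rewrite orbT.
Qed.

Lemma eliminateP n k vars I : all_hold I -> eliminate n k vars I -> False.
Proof.
have base J : all_hold J ->
    has (fun c : cons_t => c.1.1 && all (fun a => a == 0) c.1.2) J -> False.
  move=> hJ /hasP[[[b c] r] /hJ + /andP[/= b1 c0]]; rewrite /cholds /= b1.
  suff -> : lval c env = 0 by rewrite ltxx.
  elim: c env c0 {hJ} => [|a c IHc] [|x e] //= /andP[/eqP-> c0].
  by rewrite mulr0z add0r IHc.
elim: n k vars I => /= [|n IH] k vars I hI; case/orP=> [/(base _ hI)|] //.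
case: vars => // i vars; apply: IH.
by move=> c /prune_sub; apply: fm_stepP.
Qed.

Lemma refuteP i vars E I : (forall c, c \in E -> eholds c) ->
  all_hold I -> refute i vars E I -> False.
Proof.
elim: i vars E I => /= [|j i IH] vars E I hE hI.
  by apply: eliminateP => c /prune_sub; exact: hI.
case E1: pick_eq => [[q E']|]; last exact: IH.
have [qi qE sE] := pick_eqP E1; apply: IH.
  by move=> _ /mapP[c cE ->]; apply: subst_eqE; apply: hE => //; apply: sE.
move=> c /mapP[d dI ->].
by apply: subst_eqP => //; [exact: hE|exact: hI].
Qed.

Inductive hyp :=
  | HLe of zexpr & zexpr | HLt of zexpr & zexpr | HEq of zexpr & zexpr.

Definition hyp_holds h : Prop := match h with
  | HLe t u => zeval t <= zeval u
  | HLt t u => zeval t < zeval u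
  | HEq t u => zeval t = zeval u
  end.

Definition zdiff t u := znorm (ZAdd u (ZOpp t)).

Fixpoint hyp_eqs (hs : seq hyp) : seq linf :=
  if hs is h :: hs' then
    if h is HEq t u then zdiff t u :: hyp_eqs hs' else hyp_eqs hs'
  else [::].

Fixpoint hyp_ineqs (k : nat) (hs : seq hyp) : seq cons_t :=
  if hs is h :: hs' then
    match h with
    | HLe t u =>
        (false, zdiff t u, ncons k false [:: true]) :: hyp_ineqs k.+1 hs'
    | HLt t u =>
        (true, zdiff t u, ncons k false [:: true]) :: hyp_ineqs k.+1 hs'
    | HEq _ _ => hyp_ineqs k hs'
    end
  else [::].

Fixpoint hyps_hold hs : Prop :=
  if hs is h :: hs' then hyp_holds h /\ hyps_hold hs' else True.

Lemma oag_refute hs : hyps_hold hs ->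
  refute (iota 0 (size env)) [::] (hyp_eqs hs) (hyp_ineqs 0 hs) -> False.
Proof.
have zdP t u : lval (zdiff t u) env = zeval u - zeval t by rewrite -znormP.
move=> hh; apply: refuteP.
  elim: hs hh => //= h hs IH [hh /IH{}IH].
  case: h hh => t u /= hh c; try exact: IH.
  by rewrite inE => /orP[/eqP->|/IH//]; rewrite /eholds zdP hh subrr.
elim: hs 0%N hh => //= h hs IH k [hh /IH{}IH].
case: h hh => t u /= hh c; try exact: IH.
  by rewrite inE => /orP[/eqP->|/IH//]; rewrite /cholds zdP /= oag_subr_ge0.
by rewrite inE => /orP[/eqP->|/IH//]; rewrite /cholds zdP /= oag_subr_gt0.
Qed.
End Soundness.

Ltac oag_mem x env :=
  lazymatch env with
  | nil => constr:(false)
  | cons ?y ?env' => match constr:(Set) with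
     | _ => let _ := match constr:(Set) with _ => constr_eq x y end in constr:(true)
     | _ => oag_mem x env' end
  end.
Ltac oag_ins x env :=
  let b := oag_mem x env in
  lazymatch b with true => env | false => constr:(cons x env) end.
Ltac oag_atoms t env :=
  lazymatch t with
  | @GRing.add _ ?a ?b => let env := oag_atoms a env in oag_atoms b env
  | @GRing.opp _ ?a => oag_atoms a env
  | @GRing.natmul _ ?a _ => oag_atoms a env
  | @GRing.zero _ => env
  | _ => oag_ins t env
  end.
Ltac oag_index x env :=
  lazymatch env with
  | cons ?y ?env' => match constr:(Set) with
     | _ => let _ := match constr:(Set) with _ => constr_eq x y end in constr:(O)
     | _ => let n := oag_index x env' in constr:(S n) end
  end.
Ltac oag_reify t env :=
  lazymatch t with
  | @GRing.add _ ?a ?b =>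
      let a := oag_reify a env in let b := oag_reify b env in constr:(ZAdd a b)
  | @GRing.opp _ ?a => let a := oag_reify a env in constr:(ZOpp a)
  | @GRing.natmul _ ?a ?n => let a := oag_reify a env in constr:(ZMul a n)
  | @GRing.zero _ => constr:(ZZero)
  | _ => let n := oag_index t env in constr:(ZVar n)
  end.

Definition oag_of (L : oagType) (x : L) : L := x.

Ltac oag_core a :=
  let r := constr:(oag_of a) in
  let L := lazymatch r with @oag_of ?L _ => L end in
  let rec revert_all :=
    match goal with
    | H : is_true (@Order.le _ _ ?a ?b) |- _ =>
        let T := type of a in unify T (OrderedAbGroup.sort L); revert H; revert_all
    | H : is_true (@Order.lt _ _ ?a ?b) |- _ =>
        let T := type of a in unify T (OrderedAbGroup.sort L); revert H; revert_all
    | H : @eq ?T ?a ?b |- _ => unify T (OrderedAbGroup.sort L); revert H; revert_all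
    | _ => idtac
    end in
  let rec atoms g env :=
    lazymatch g with
    | is_true (@Order.le _ _ ?a ?b) -> ?g' =>
       let env := oag_atoms a env in let env := oag_atoms b env in atoms g' env
    | is_true (@Order.lt _ _ ?a ?b) -> ?g' =>
       let env := oag_atoms a env in let env := oag_atoms b env in atoms g' env
    | @eq _ ?a ?b -> ?g' =>
       let env := oag_atoms a env in let env := oag_atoms b env in atoms g' env
    | False => env
    end in
  let rec reif g env :=
    lazymatch g with
    | is_true (@Order.le _ _ ?a ?b) -> ?g' =>
       let a := oag_reify a env in let b := oag_reify b env in
       let r := reif g' env in constr:(cons (HLe a b) r)
    | is_true (@Order.lt _ _ ?a ?b) -> ?g' =>
       let a := oag_reify a env in let b := oag_reify b env in
       let r := reif g' env in constr:(cons (HLt a b) r)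
    | @eq _ ?a ?b -> ?g' =>
       let a := oag_reify a env in let b := oag_reify b env in
       let r := reif g' env in constr:(cons (HEq a b) r)
    | False => constr:(@nil hyp)
    end in
  revert_all;
  lazymatch goal with |- ?g =>
    let env := atoms g (@nil (OrderedAbGroup.sort L)) in
    let hs := reif g env in
    intros;
    apply: (@oag_refute L env hs);
      [ repeat (split; [assumption|]); exact I | vm_compute; reflexivity ]
  end.

(** Proves linear equalities and inequalities in an ordered abelian group from
    the linear hypotheses of the context. In a multiple [x *+ n], [n] has to be a
    numeral. *)
Ltac oag :=
  intros;
  repeat match goal with
    | H : is_true (_ && _) |- _ => case/andP: H => ? ?
    | H : _ /\ _ |- _ => case: H => ? ?
  end;
  lazymatch goal with
  | |- is_true (_ && _) => apply/andP; split; oag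
  | |- _ /\ _ => split; oag
  | |- is_true (@Order.le _ _ ?a ?b) =>
      rewrite oag_leNgt; apply/negP; intro; oag_core a
  | |- is_true (@Order.lt _ _ ?a ?b) =>
      rewrite oag_ltNge; apply/negP; intro; oag_core a
  | |- @eq ?T ?a ?b => apply: le_anti; apply/andP; split; oag
  | |- False => match goal with
      | H : is_true (@Order.le _ _ ?a ?b) |- _ => oag_core a
      | H : is_true (@Order.lt _ _ ?a ?b) |- _ => oag_core a
      end
  end.

Lemma oag_le_total (L : oagType) (x y : L) : x <= y \/ y <= x.
Proof. exact/orP/oag_total. Qed.

Lemma oabs_ge0 (L : oagType) (x : L) : 0 <= x -> oabs x = x.
Proof.
by move=> x0; rewrite /oabs maxEle; case: ifPn => // h; oag.
Qed.

Lemma oabs_le0 (L : oagType) (x : L) : x <= 0 -> oabs x = - x.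
Proof.
move=> x0; rewrite /oabs maxEle; case: ifPn => //.
by rewrite -oag_ltNge => h; oag.
Qed.

Lemma oabs_cases (L : oagType) (x : L) :
  (0 <= x /\ oabs x = x) \/ (x <= 0 /\ oabs x = - x).
Proof.
case: (oag_le_total 0 x) => x0; first by left; rewrite oabs_ge0.
by right; rewrite oabs_le0.
Qed.

(** * Trees as median hyperbolic spaces *)

Section Betweenness.
Variables (L : oagType) (X : lmetric L).
Implicit Types (x y z m p : X) (S : set X).

Definition btw x z y : Prop := dist x z + dist z y = dist x y.

Lemma distxx x : dist x x = 0. Proof. by apply/dist_eq0. Qed.

Lemma dist_le0 x y : dist x y <= 0 -> x = y.
Proof. by move=> h; apply/dist_eq0; have := dist_ge0 x y; oag. Qed.

Lemma btwC x z y : btw x z y -> btw y z x.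
Proof. by rewrite /btw !(distC y) (distC z x) addrC. Qed.

Lemma btwxx x y : btw x x y. Proof. by rewrite /btw distxx add0r. Qed.
Lemma btwyy x y : btw x y y. Proof. by rewrite /btw distxx addr0. Qed.

Lemma btw_trans x p m y : btw x p m -> btw x m y -> btw x p y /\ btw p m y.
Proof.
rewrite /btw => h1 h2; have := dist_triangle p m y; have := dist_triangle x p y.
split; oag.
Qed.

(** The three properties that are used of a tree: points at all intermediate
    distances, Gromov's four-point inequality, and medians. Unlike the
    definition by segments, they are statements about distances alone. *)
Record mtree : Prop := MTree {
  mt_geod : forall x y t, 0 <= t <= dist x y ->
    exists z, dist x z = t /\ dist z y = dist x y - t;
  mt_4pt : forall x y z w,
    dist x y + dist z w <= dist x z + dist y w \/
    dist x y + dist z w <= dist x w + dist y z;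
  mt_med : forall x y z, exists m, [/\ btw x m y, btw x m z & btw y m z]
}.

(** With [segP], this replaces the parametrisation in the definition of a segment
    by the distance to one end. *)
Lemma mkseg x y S :
  (forall z, S z -> btw x z y) ->
  (forall t, 0 <= t <= dist x y -> exists2 z, S z & dist x z = t) ->
  (forall z z', S z -> S z' -> dist z z' = oabs (dist x z - dist x z')) ->
  segment_between x y S.
Proof.
move=> h1 h2 h3; have d0 := dist_ge0 x y.
pose f t := match pselect (0 <= t <= dist x y) with
  | left h => projT1 (cid2 (h2 t h)) | right _ => x end.
have fP t : 0 <= t <= dist x y -> S (f t) /\ dist x (f t) = t.
  by move=> h; rewrite /f; case: pselect => // h'; case: cid2.
exists 0, (dist x y), f; split=> //.
- by move=> s t /fP[Ss ds] /fP[St dt]; rewrite h3 // ds dt.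
- have [|S0 d] := fP 0; first by rewrite lexx.
  by apply/esym/dist_le0; rewrite d.
- have [|S0 d] := fP (dist x y); first by rewrite lexx andbT.
  by apply/dist_le0; move: (h1 _ S0); rewrite /btw d => h; oag.
apply/seteqP; split=> [z Sz|_ [t /fP[Ht _] <-//]].
have zt : 0 <= dist x z <= dist x y.
  by move: (h1 _ Sz) (dist_ge0 x z) (dist_ge0 z y); rewrite /btw => *; oag.
exists (dist x z) => //; have [Sf df] := fP _ zt.
by apply: dist_le0; rewrite h3 // df subrr oabs_ge0.
Qed.

Lemma segP x y S : segment_between x y S ->
  [/\ S x /\ S y, (forall z, S z -> btw x z y),
  (forall t, 0 <= t <= dist x y -> exists2 z, S z & dist x z = t) &
  (forall z z', S z -> S z' -> dist z z' = oabs (dist x z - dist x z'))].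
Proof.
move=> [a [b [f [ab fd fa fb ->]]]].
have fda t : a <= t <= b -> dist x (f t) = t - a.
  move=> h; rewrite -fa fd ?lexx //; rewrite oabs_le0; first oag.
  by oag.
have dxy : dist x y = b - a by rewrite -fb fda // lexx andbT.
split.
- by split; [exists a|exists b] => //=; rewrite lexx ?andbT.
- move=> _ [t /= h <-]; rewrite /btw fda // -fb.
  rewrite fd ?lexx ?andbT // fda ?lexx ?andbT //.
  by rewrite oabs_le0; oag.
- move=> t; rewrite dxy => h; exists (f (t + a)); last by rewrite fda; oag.
  by exists (t + a) => //=; oag.
move=> _ _ [s /= hs <-] [t /= ht <-]; rewrite fd // !fda //; congr oabs; oag.
Qed.

Lemma seg_sym x y S : segment_between x y S -> segment_between y x S.
Proof.
move=> /segP[[Sx Sy] h1 h2 h3]; apply: mkseg.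
- by move=> z /h1 /btwC.
- move=> t ht; have [|z Sz xz] := h2 (dist x y - t).
    by move: ht; rewrite (distC y); oag.
  exists z => //; move: (h1 _ Sz); rewrite /btw xz (distC y) => h; oag.
move=> z z' Sz Sz'; rewrite h3 //; move: (h1 _ Sz) (h1 _ Sz'); rewrite /btw.
rewrite !(distC y) => e e'; rewrite (_ : dist z y - _ = dist x z' - dist x z).
  case: (oabs_cases (dist x z - dist x z')) => -[s ->].
    by rewrite oabs_le0; oag.
  by rewrite oabs_ge0; oag.
oag.
Qed.

(** A segment is identified with an interval by the distance to one end, and
    all positions are compared there. *)
Lemma subseg u v U m y : segment_between u v U -> U m -> U y ->
  segment_between m y [set p | U p /\ btw m p y].
Proof.
move=> /segP[_ h1 h2 h3] Um Uy; have := h3 _ _ Um Uy.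
have m1 := h1 _ Um; have y1 := h1 _ Uy; rewrite /btw in m1 y1.
have m0 := dist_ge0 u m; have m0' := dist_ge0 m v.
have y0 := dist_ge0 u y; have y0' := dist_ge0 y v.
case: (oabs_cases (dist u m - dist u y)) => -[s ->] dmy; apply: mkseg;
  try by move=> z [].
- move=> t ht; have [|z Uz uz] := h2 (dist u m - t); first oag.
  have mz : dist m z = t by rewrite h3 // uz oabs_ge0; oag.
  exists z => //; split=> //; rewrite /btw mz h3 // uz oabs_ge0; oag.
- move=> z z' [Uz]; rewrite /btw (h3 m z) // (h3 z y) // => bz.
  move=> [Uz']; rewrite (h3 m z') // (h3 z' y) // (h3 z z') // => bz'.
  suff [e1 e2] : dist u z <= dist u m /\ dist u z' <= dist u m.
    rewrite (oabs_ge0 (x := dist u m - dist u z)); last oag.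
    rewrite (oabs_ge0 (x := dist u m - dist u z')); last oag.
    case: (oabs_cases (dist u z - dist u z')) => -[s' ->].
      by rewrite oabs_le0; oag.
    by rewrite oabs_ge0; oag.
  split; first by move: bz;
    case: (oabs_cases (dist u m - dist u z)) => -[? ->];
    case: (oabs_cases (dist u z - dist u y)) => -[? ->] ?; oag.
  by move: bz';
    case: (oabs_cases (dist u m - dist u z')) => -[? ->];
    case: (oabs_cases (dist u z' - dist u y)) => -[? ->] ?; oag.
- move=> t ht; have [|z Uz uz] := h2 (dist u m + t); first oag.
  have mz : dist m z = t by rewrite h3 // uz oabs_le0; oag.
  exists z => //; split=> //; rewrite /btw mz h3 // uz oabs_le0; oag.
move=> z z' [Uz]; rewrite /btw (h3 m z) // (h3 z y) // => bz.
move=> [Uz']; rewrite (h3 m z') // (h3 z' y) // (h3 z z') // => bz'.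
suff [e1 e2] : dist u m <= dist u z /\ dist u m <= dist u z'.
  rewrite (oabs_le0 (x := dist u m - dist u z)); last oag.
  rewrite (oabs_le0 (x := dist u m - dist u z')); last oag.
  case: (oabs_cases (dist u z - dist u z')) => -[s' ->].
    by rewrite oabs_ge0; oag.
  by rewrite oabs_le0; oag.
split; first by move: bz;
  case: (oabs_cases (dist u m - dist u z)) => -[? ->];
  case: (oabs_cases (dist u z - dist u y)) => -[? ->] ?; oag.
by move: bz';
  case: (oabs_cases (dist u m - dist u z')) => -[? ->];
  case: (oabs_cases (dist u z' - dist u y)) => -[? ->] ?; oag.
Qed.

Section FromSegments.
Hypothesis XT : is_ltree X.

Lemma ltree_seg x y : exists S, segment_between x y S.
Proof. by case: XT. Qed.

(** The intersection of two segments with the same ends is itself a segment and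
    contains both ends, so it has a point at every intermediate distance. *)
Lemma seg_sub x y S S' :
  segment_between x y S -> segment_between x y S' -> S `<=` S'.
Proof.
move=> hS hS' p Sp; case: XT => _ _ /(_ x y y _ _ hS hS') [u [v hT]] _.
have [[Sx Sy] h1 _ h3] := segP hS; have [[Sx' Sy'] _ _ _] := segP hS'.
have [_ k1 k2 k3] := segP hT.
have Tx : (S `&` S') x by []. have Ty : (S `&` S') y by [].
have bp := h1 _ Sp; rewrite /btw in bp.
have ux := k1 _ Tx; have uy := k1 _ Ty; rewrite /btw in ux uy.
have := k3 _ _ Tx Ty; have p0 := dist_ge0 x p; have p1 := dist_ge0 p y.
have y0 := dist_ge0 u y; have y1 := dist_ge0 y v.
have x0 := dist_ge0 u x; have x1 := dist_ge0 x v.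
have fin z t : (S `&` S') z -> dist u z = t ->
    oabs (dist u x - t) = dist x p -> S' p.
  move=> [Sz Sz'] uz e; suff <- : z = p by [].
  apply: dist_le0; rewrite h3 // (_ : dist x z = dist x p) ?subrr ?oabs_ge0 //.
  by rewrite -e -uz k3.
case: (oabs_cases (dist u x - dist u y)) => -[s ->] dxy.
  have [|z Tz uz] := k2 (dist u x - dist x p); first oag.
  by apply: (fin z _ Tz uz); rewrite oabs_ge0; oag.
have [|z Tz uz] := k2 (dist u x + dist x p); first oag.
by apply: (fin z _ Tz uz); rewrite oabs_le0; oag.
Qed.

Lemma seg_uniq x y S S' :
  segment_between x y S -> segment_between x y S' -> S = S'.
Proof.
move=> h h'.
by apply/seteqP; split; [exact: (seg_sub h h')|exact: (seg_sub h' h)].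
Qed.

(** The segments from [x] to [y] and to [z] meet in a segment [x, m]. Beyond [m]
    they have only [m] in common, so by the last axiom of a tree their union is a
    segment. In it [m] lies between [y] and [z]: otherwise one of these points
    would belong to both branches. *)
Lemma ltree_med x y z S : segment_between x y S ->
  exists m, [/\ S m, btw x m y, btw x m z & btw y m z].
Proof.
move=> hS; have [S' hS'] := ltree_seg x z.
have [[Sx Sy] h1 _ h3] := segP hS; have [[Sx' Sz'] h1' _ h3'] := segP hS'.
case: (XT) => _ _ /(_ _ _ _ _ _ hS hS') [u [v hT]] /(_ _ _ _ _ _ _ _) ax3.
have [m hm] : exists m, segment_between x m (S `&` S').
  have [[[Su Su'] [Sv Sv']] k1 _ _] := segP hT.
  have := k1 x (conj Sx Sx'); rewrite /btw (h3 u v) // (distC u).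
  have u0 := dist_ge0 x u; have v0 := dist_ge0 x v.
  case: (oabs_cases (dist x u - dist x v)) => -[s ->] e.
    by exists u; have -> : x = v; [apply: dist_le0; oag|apply: seg_sym].
  by exists v; have -> : x = u; [apply: dist_le0; oag|].
have [[_ [Sm Sm']] k1 _ _] := segP hm.
have hS1 := subseg hS Sm Sy; have hS2 := subseg hS' Sm' Sz'.
exists m; split; [by []|exact: h1|exact: h1'|].
have [|u' [v' hU]] := ax3 _ _ _ _ _ hS1 hS2.
  apply/seteqP; split=> [p [[Sp b1] [Sp' b2]]|_ ->]; last first.
    by split; split=> //; exact: btwxx.
  have := k1 p (conj Sp Sp'); have := h1 _ Sm; move: b1; rewrite /btw => *.
  apply: dist_le0; have := dist_triangle x p y; have := distC m p.
  by oag.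
set U := _ `|` _ in hU.
have Um : U m by left; split=> //; exact: btwxx.
have Uy : U y by left; split=> //; exact: btwyy.
have Uz : U z by right; split=> //; exact: btwyy.
have hmy := seg_uniq (subseg hU Um Uy) hS1.
have hmz := seg_uniq (subseg hU Um Uz) hS2.
have mm : forall p, btw m p y -> btw m p z -> U p -> p = m.
  move=> p b1 b2 Up.
  have [Sp _] : [set p | S p /\ btw m p y] p by rewrite -hmy.
  have [Sp' _] : [set p | S' p /\ btw m p z] p by rewrite -hmz.
  have := k1 p (conj Sp Sp'); have := h1 _ Sm; move: b1; rewrite /btw => *.
  apply: dist_le0; have := dist_triangle x p y; have := distC m p.
  by oag.
have [_ _ _ l3] := segP hU.
have my := l3 _ _ Um Uy; have mz := l3 _ _ Um Uz; have yz := l3 _ _ Uy Uz.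
have yz0 : btw m y z -> y = m by move=> b; apply: mm => //; exact: btwyy.
have zy0 : btw m z y -> z = m by move=> b; apply: mm => //; exact: btwyy.
have e : btw y m z \/ btw m y z \/ btw m z y.
  rewrite /btw (distC y m) (distC z y) yz my mz.
  case: (oabs_cases (dist u' m - dist u' y)) => -[? ->];
  case: (oabs_cases (dist u' y - dist u' z)) => -[? ->];
  case: (oabs_cases (dist u' m - dist u' z)) => -[? ->];
  first [by left; oag|by right; left; oag|by right; right; oag].
case: e => [//|[/yz0 ->|/zy0 ->]]; [exact: btwxx|exact: btwyy].
Qed.

Lemma ltree_mtree : mtree.
Proof.
split=> [x y t ht|x y z w|x y z].
- have [S /segP[_ h1 h2 _]] := ltree_seg x y.
  have [z Sz xz] := h2 _ ht; exists z; split=> //.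
  by have := h1 _ Sz; rewrite /btw xz => h; oag.
- have [S hS] := ltree_seg x y; have [_ _ _ h3] := segP hS.
  (* the branch points of z and w on [x, y]: the path from z to w follows [x, y]
     between them, which gives the upper bound for their distance *)
  have [m1 [S1 a1 a2 a3]] := ltree_med z hS.
  have [m2 [S2 b1 b2 b3]] := ltree_med w hS.
  rewrite /btw in a1 a2 a3 b1 b2 b3.
  have := h3 _ _ S1 S2.
  have t1 := dist_triangle z m1 w; have t2 := dist_triangle m1 m2 w.
  have := distC m1 y; have := distC m2 y; have := distC z m1.
  have := distC m1 m2; have t3 := dist_triangle z m2 w.
  have t4 := dist_triangle z m1 m2.
  case: (oabs_cases (dist x m1 - dist x m2)) => -[? ->] *; [left|right]; oag.
have [S hS] := ltree_seg x y.
by have [m [_ ? ? ?]] := ltree_med z hS; exists m.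
Qed.
End FromSegments.

Section FromMedians.
Hypothesis XT : mtree.

(** This is the four-point inequality for the pairs (x, y) and (z, z'). It makes a
    point between [x] and [y] unique for its distance to [x], so that
    betweenness sets are segments. *)
Lemma mtree_pos x y z z' : btw x z y -> btw x z' y ->
  dist x z <= dist x z' -> btw x z z'.
Proof.
rewrite /btw => h h' le; have := dist_triangle x z z'.
have := distC y z'; have := distC y z; have := distC z z'.
have := dist_ge0 z z'.
by case: (mt_4pt XT x y z z') => *; oag.
Qed.

Lemma mtree_inj x y z z' : btw x z y -> btw x z' y ->
  dist x z = dist x z' -> z = z'.
Proof.
move=> h h' e; have := mtree_pos h h'; rewrite e lexx /btw => /(_ isT) b.
by apply: dist_le0; oag.
Qed.

Lemma mtree_seg x y : segment_between x y [set z | btw x z y].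
Proof.
apply: mkseg => //= [t ht|z z' hz hz'].
  have [z [xz zy]] := mt_geod XT ht; exists z => //=.
  by rewrite /btw xz zy; oag.
case: (oag_le_total (dist x z) (dist x z')) => le.
  by have := mtree_pos hz hz' le; rewrite /btw oabs_le0; oag.
by have := mtree_pos hz' hz le; have := distC z z'; rewrite /btw oabs_ge0; oag.
Qed.

Lemma mtree_segE x y S : segment_between x y S -> S = [set z | btw x z y].
Proof.
move=> /segP[_ h1 h2 _]; apply/seteqP; split=> // z bz.
have [|z' Sz' xz'] := h2 (dist x z).
  have := dist_ge0 x z; have := dist_ge0 z y.
  by move: bz; rewrite /= /btw => *; oag.
by rewrite -(mtree_inj (h1 _ Sz') bz xz').
Qed.

Lemma mtree_in_seg x y : in_seg x y = [set z | btw x z y].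
Proof.
apply/seteqP; split=> [z [S /mtree_segE -> //]|z bz].
by exists [set z | btw x z y] => //; exact: mtree_seg.
Qed.

Lemma mtree_ltree : inhabited X -> is_ltree X.
Proof.
split=> // [x y|x y z S S' /mtree_segE -> /mtree_segE ->|].
- by eexists; exact: mtree_seg.
- have [m [xy xz yz]] := mt_med XT x y z.
  exists x, m; suff -> : [set p | btw x p y] `&` [set p | btw x p z] =
      [set p | btw x p m] by exact: mtree_seg.
  apply/seteqP; split=> [p /= [py pz]|p /= pm]; last first.
    by split; [have [] := btw_trans pm xy|have [] := btw_trans pm xz].
  apply: (mtree_pos py xy); move: xy xz yz py pz; rewrite /btw => *.
  by have := dist_triangle y p z; have := distC y p; have := distC y m; oag.
move=> x y z S S' /mtree_segE -> /mtree_segE -> e.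
have [m [xy xz yz]] := mt_med XT x y z.
have mx : m = x.
  have : ([set p | btw x p y] `&` [set p | btw x p z]) m by [].
  by rewrite e.
rewrite {}mx in xy xz yz; exists y, z.
suff -> : [set p | btw x p y] `|` [set p | btw x p z] = [set p | btw y p z].
  exact: mtree_seg.
apply/seteqP; split=> [p /= [py|pz]|p /= pz].
- by have [] := btw_trans (btwC py) yz.
- by have [] := btw_trans (btwC pz) (btwC yz); move=> /btwC.
case: (oag_le_total (dist y p) (dist y x)) => le.
  by left; apply/btwC/(mtree_pos pz yz).
right; have := mtree_pos yz pz le; move: pz yz; rewrite /btw => *; oag.
Qed.

End FromMedians.
End Betweenness.

(** * Ends of full type as horofunctions *)

Section Horo.
Variables (L : oagType) (X : lmetric L).
Implicit Types (x y z w p q r : X) (A : set X) (dl : X -> L).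

(** When [dl] is an end map towards an end of full type, this says that [p] lies
    on the ray from [x] to this end. *)
Definition beyond dl x p : Prop := dl p = dl x + dist x p.

(** The functions that are end maps towards some end of full type; see
    [end_horo] and [horo_is_end]. The end itself is recovered as [hclass dl], so
    ends and their rays can be handled through inequalities. *)
Record horo dl : Prop := Horo {
  ho_dir : forall x y, exists p, beyond dl x p /\ beyond dl y p;
  ho_full : forall x l, 0 <= l -> exists p, beyond dl x p /\ dist x p = l
}.

Definition hray dl x : set X := [set p | beyond dl x p].

Definition hclass dl : ray_class X := fun x A => A = hray dl x.

(** The maximum of the sum of two end maps is attained exactly along the line that
    joins the two ends. Such a point exists as soon as the ends differ; see
    [horo_dichotomy]. *)
Definition sep_at dl dl' z := forall a, dl a + dl' a <= dl z + dl' z.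

Lemma ray_to_hclass dl x : ray_to x (hclass dl) = hray dl x.
Proof.
by apply/seteqP; split=> [p [A -> //]|p hp]; exists (hray dl x).
Qed.

Lemma beyond_refl dl x : beyond dl x x.
Proof. by rewrite /beyond distxx addr0. Qed.

(** Far out on a common ray of [x] and [y], both differences of [dl] are
    distances. *)
Lemma ho_lip dl x y : horo dl -> dl y <= dl x + dist x y.
Proof.
move=> h; have [p []] := ho_dir h x y; rewrite /beyond => *.
by have := dist_triangle x y p; oag.
Qed.

Lemma beyond_trans dl x p q : horo dl ->
  beyond dl x p -> beyond dl p q -> beyond dl x q /\ btw x p q.
Proof.
rewrite /beyond /btw => h *; have := ho_lip x q h.
by have := dist_triangle x p q; oag.
Qed.

Lemma beyond_btw dl x p r : horo dl ->
  beyond dl x r -> btw x p r -> beyond dl x p /\ beyond dl p r.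
Proof.
rewrite /beyond /btw => h *; have := ho_lip x p h.
by have := ho_lip p r h; oag.
Qed.

Lemma ho_far (s : seq X) dl : horo dl -> inhabited X ->
  exists p, forall x, List.In x s -> beyond dl x p.
Proof.
move=> h [x0]; elim: s => [|x s [p IH]]; first by exists x0.
have [q [xq pq]] := ho_dir h x p; exists q => y /= [<- //|/IH yp].
by have [] := beyond_trans h yp pq.
Qed.

Lemma ho_unbounded dl l : horo dl -> inhabited X -> exists p, l <= dl p.
Proof.
move=> h [x0]; case: (oag_le_total (dl x0) l) => le; last by exists x0.
have [|p [b e]] := @ho_full _ h x0 (l - dl x0); first oag.
by exists p; rewrite b e; oag.
Qed.

Hypothesis XT : mtree X.

Lemma beyond_lin dl x p q : horo dl -> beyond dl x p -> beyond dl x q ->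
  dist x p <= dist x q -> beyond dl p q /\ btw x p q.
Proof.
move=> h xp xq le; have [r [pr qr]] := ho_dir h p q.
have [xr bp] := beyond_trans h xp pr; have [_ bq] := beyond_trans h xq qr.
have b := mtree_pos XT bp bq le; split=> //.
by move: b xp xq; rewrite /btw /beyond; oag.
Qed.

Lemma beyond_inj dl x p q : horo dl -> beyond dl x p -> beyond dl x q ->
  dist x p = dist x q -> p = q.
Proof.
move=> h xp xq e; have [] := beyond_lin h xp xq; first by rewrite e.
by rewrite /btw => _ b; apply: dist_le0; oag.
Qed.

Lemma linear_fromP x A p q : linear_from x A -> A p -> A q ->
  dist x p <= dist x q -> btw x p q.
Proof.
move=> [_ [f hf] [Ax hx]] Ap Aq le.
have xp := hf _ _ Ax Ap; have xq := hf _ _ Ax Aq; have pq := hf _ _ Ap Aq.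
have hpq : btw p x q -> btw x p q.
  move=> b; case: (hx _ _ Ap Aq b) => e; subst x; first exact: btwxx.
  suff -> : q = p by exact: btwxx.
  by apply: dist_le0; move: le; rewrite distxx (distC q).
have [//|] : btw x p q \/ btw p x q; last exact: hpq.
rewrite /btw (distC p x).
by case: (oabs_cases (f x - f p)) => -[? e1];
  case: (oabs_cases (f x - f q)) => -[? e2];
  case: (oabs_cases (f p - f q)) => -[? e3];
  rewrite e1 in xp; rewrite e2 in xq; rewrite e3 in pq;
  first [by left; oag|by right; oag].
Qed.

Lemma between_beyond x a b c : btw x a b -> btw a c b ->
  btw x c b /\ dist x a <= dist x c.
Proof.
rewrite /btw => *; have := dist_triangle x c b; have := dist_triangle x a c.
by have := dist_ge0 a c; oag.
Qed.

(** The tail of a ray beyond [w] competes with the intersection of two equivalent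
    rays, which is maximal among the linear subtrees starting at [w]; this is how
    that intersection is identified in [end_horo]. *)
Lemma linear_tail x A w : linear_from x A -> A w ->
  linear_from w [set p | A p /\ btw x w p].
Proof.
move=> hA Aw; have [[_ hs] [f hf] hx] := hA; split.
- split; first by exists w; split=> //; exact: btwyy.
  have W a b c : A a /\ btw x w a -> A b /\ btw x w b ->
      dist x a <= dist x b -> btw a c b -> A c /\ btw x w c.
    move=> [Aa wa] [Ab wb] le ac.
    have ba := linear_fromP hA Aa Ab le; have [bc lc] := between_beyond ba ac.
    have Ac : A c by apply: hs Aa Ab _ _; rewrite mtree_in_seg.
    split=> //; apply: linear_fromP hA Aw Ac _.
    by move: wa; rewrite /btw; have := dist_ge0 w a; oag.
  move=> a b ha hb c; rewrite mtree_in_seg //= => bc.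
  case: (oag_le_total (dist x a) (dist x b)) => le; first exact: (W a b).
  by apply: (W b a) => //; exact: btwC.
- by exists f => a b [Aa _] [Ab _]; exact: hf.
split; first by split=> //; exact: btwyy.
have W y z : A y /\ btw x w y -> A z /\ btw x w z -> dist x y <= dist x z ->
    btw y w z -> y = w.
  move=> [Ay wy] [Az wz] le b; have := linear_fromP hA Ay Az le.
  move: b wy wz; rewrite /btw => *; apply: dist_le0.
  by have := distC w y; oag.
move=> y z hy hz b; case: (oag_le_total (dist x y) (dist x z)) => le.
  by left; exact: (W y z).
by right; apply: (W z y) => //; exact: btwC.
Qed.

Lemma hray_linear dl x : horo dl -> linear_from x (hray dl x).
Proof.
move=> h; split.
- split; first by exists x; exact: beyond_refl.
  have W a b c : beyond dl x a -> beyond dl x b ->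
      dist x a <= dist x b -> btw a c b -> beyond dl x c.
    move=> xa xb le ac; have [_ ab] := beyond_lin h xa xb le.
    by have [xc _] := between_beyond ab ac; have [] := beyond_btw h xb xc.
  move=> a b ha hb c; rewrite mtree_in_seg //= => bc.
  case: (oag_le_total (dist x a) (dist x b)) => le; first exact: (W a b).
  by apply: (W b a) => //; exact: btwC.
- exists dl => a b xa xb.
  case: (oag_le_total (dist x a) (dist x b)) => le.
    have [] := beyond_lin h xa xb le; rewrite /beyond => -> _.
    by have d0 := dist_ge0 a b; rewrite oabs_le0; oag.
  have [] := beyond_lin h xb xa le; rewrite (distC a) /beyond => -> _.
  by have d0 := dist_ge0 b a; rewrite oabs_ge0; oag.
split; first exact: beyond_refl.
move=> y z xy xz b; case: (oag_le_total (dist x y) (dist x z)) => le.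
  left; have [_] := beyond_lin h xy xz le; move: b; rewrite /btw => *.
  by apply: dist_le0; have := distC x y; oag.
right; have [_] := beyond_lin h xz xy le; move: b; rewrite /btw => *.
apply: dist_le0; have := distC x y; have := distC x z.
by have := distC z y; oag.
Qed.

(** Since [hray dl x] has a point at every distance from [x], there is no room for
    a longer linear subtree. *)
Lemma hray_max dl x B : horo dl -> linear_from x B -> hray dl x `<=` B ->
  B `<=` hray dl x.
Proof.
move=> h hB sB b Bb; have [p [xp dp]] := @ho_full _ h x _ (dist_ge0 x b).
suff -> : b = p by [].
have := linear_fromP hB Bb (sB _ xp); rewrite dp lexx => /(_ isT).
by rewrite /btw => e; apply: dist_le0; oag.
Qed.

Lemma hray_ray dl x : horo dl -> is_ray x (hray dl x).
Proof. by move=> h; split; [exact: hray_linear|move=> B; exact: hray_max]. Qed.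

(** Two rays [hray dl x0] and [hray dl x] meet in the ray from the median of [x0],
    [x] and a common point. Conversely a ray equivalent to [hray dl x0] contains a
    whole ray [hray dl w], hence by convexity the ray [hray dl x], which is
    already maximal. *)
Lemma horo_is_end dl : horo dl -> inhabited X -> is_end (hclass dl).
Proof.
move=> h [x0]; exists x0, (hray dl x0); split; first exact: hray_ray.
have tail w A x : hray dl x0 w -> is_ray w (hray dl x0 `&` A) ->
    (forall z, (hray dl x0 `&` A) z -> btw x0 w z /\ btw x w z) ->
    hray dl x0 `&` A = hray dl w.
  move=> xw [_ hm] hz.
  have s : hray dl x0 `&` A `<=` hray dl w.
    move=> z hA; have [b _] := hz _ hA; case: hA => xz _.
    by have [] := beyond_btw h xz b.
  by apply/seteqP; split=> //; apply: hm => //; exact: hray_linear.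
move=> x A; split=> [->|[rA [w [rw hz]]]].
  split; first exact: hray_ray.
  have [r [r0 r1]] := ho_dir h x0 x; have [w [b0 b1 b2]] := mt_med XT x0 x r.
  have [w0 wr] := beyond_btw h r0 b1; have [w1 _] := beyond_btw h r1 b2.
  have e : hray dl x0 `&` hray dl x = hray dl w.
    apply/seteqP; split=> [p [p0 p1]|p wp]; last first.
      by split; [have [] := beyond_trans h w0 wp
                |have [] := beyond_trans h w1 wp].
    move: w0 w1 p0 p1 b0; rewrite /hray /= /beyond /btw => w0 w1 p0 p1 b0.
    have dxw := distC x w; have := ho_lip w p h.
    by case: (mt_4pt XT x0 x w p) => *; oag.
  exists w; rewrite e; split; first exact: hray_ray.
  move=> z wz; have [_ b3] := beyond_trans h w0 wz.
  by have [_ b4] := beyond_trans h w1 wz.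
have [[_ _ [[xw Aw] _]] _] := rw.
have eR := tail w A x xw rw hz.
have wr r : hray dl w r -> btw x w r by rewrite -eR => /hz [].
have xw' : hray dl x w.
  have [r [wr' xr]] := ho_dir h w x.
  by have [] := beyond_btw h xr (wr _ wr').
have s : hray dl x `<=` A.
  move=> p xp; have [r [wr' pr]] := ho_dir h w p.
  have [xr bp] := beyond_trans h xp pr.
  have [_ Ar] : (hray dl x0 `&` A) r by rewrite eR.
  case: rA => -[[_ hs] _ [Ax _]] _.
  by apply: hs Ax Ar _ _; rewrite mtree_in_seg.
apply/seteqP; split=> //; apply: hray_max => //.
by case: rA.
Qed.

(** Equivalent rays share a tail of a fixed ray [A0], so the rays from any two
    points have a point in common; full type provides the rays and their
    points at all distances. *)
Lemma end_horo eps dl : is_end eps -> full_type eps -> end_map eps dl ->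
  horo dl /\ eps = hclass dl.
Proof.
move=> [x0 [A0 [r0 hE]]] ft em.
have exA x : exists A, eps x A.
  have : (dist x @` ray_to x eps) 0 by rewrite ft /= lexx.
  by case=> p [A hA _] _; exists A.
have bey x A p : eps x A -> A p -> beyond dl x p.
  move=> hA Ap; have := em x p; rewrite /beyond => <-; last by exists A.
  by rewrite addrC subrK.
have l0 : linear_from x0 A0 by case: r0.
have tail w A x : A0 w -> is_ray w (A0 `&` A) ->
    (forall z, (A0 `&` A) z -> btw x0 w z /\ btw x w z) ->
    forall p, A0 p -> dist x0 w <= dist x0 p -> A p.
  move=> Aw [_ hm] hz p Ap le.
  have [] // : (A0 `&` A) p.
  apply: (hm _ (linear_tail l0 Aw)); last first.
    by split=> //; exact: (linear_fromP l0 Aw Ap le).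
  by move=> z hA; have [b _] := hz _ hA; case: hA.
have dir x y : exists p, beyond dl x p /\ beyond dl y p.
  have [A hA] := exA x; have [B hB] := exA y.
  have /hE[_ [w [rw hw]]] := hA; have /hE[_ [v [rv hv]]] := hB.
  have [[_ _ [[A0w Aw] _]] _] := rw; have [[_ _ [[A0v Bv] _]] _] := rv.
  case: (oag_le_total (dist x0 w) (dist x0 v)) => le.
    by exists v; split; [apply: bey hA _; exact: (tail w A x)|exact: bey hB _].
  by exists w; split; [exact: bey hA _|apply: bey hB _; exact: (tail v B y)].
have h : horo dl.
  split=> // x l l0'; have : (dist x @` ray_to x eps) l by rewrite ft.
  by case=> p [A hA Ap] <-; exists p; split=> //; exact: bey hA Ap.
have hcl x A : eps x A -> A = hray dl x.
  move=> hA; have /hE[[_ hm] _] := hA.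
  have s : A `<=` hray dl x by move=> p; exact: bey.
  by apply/seteqP; split=> //; apply: hm => //; exact: hray_linear.
split=> //; apply/funext => x; apply/funext => A; apply/propext; split.
  exact: hcl.
by move=> ->; have [A' hA'] := exA x; rewrite -(hcl _ _ hA').
Qed.

(** At the median [m] of [z], [p], [q] the sum of the two functions exceeds its
    value at [z] by twice the distance from [z] to [m]. *)
Lemma sep_line dl dl' z p q : horo dl -> horo dl' -> sep_at dl dl' z ->
  beyond dl z p -> beyond dl' z q -> btw p z q.
Proof.
move=> h h' hz zp zq; have [m [bp bq b]] := mt_med XT z p q.
have [zm _] := beyond_btw h zp bp; have [zm' _] := beyond_btw h' zq bq.
suff -> : z = m by [].
by have := hz m; move: zm zm'; rewrite /beyond => *; apply: dist_le0; oag.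
Qed.

Lemma btw_extend p z q r : q <> z -> btw p z q -> btw z q r -> btw p z r.
Proof.
move=> ne; rewrite /btw => *; have := dist_triangle p z r.
have := distC q z; case: (mt_4pt XT p q z r); last by oag.
move=> *; case: ne; apply/esym/dist_le0; oag.
Qed.

(** If the rays from [x] to the two ends differ, they branch at some point [z],
    and the two tails beyond [z] form a line. The sum of the two functions is
    maximal at [z] by the triangle inequality between far points of this
    line. *)
Lemma horo_dichotomy dl dl' : horo dl -> horo dl' ->
  (forall x, hray dl x = hray dl' x) \/ exists z, sep_at dl dl' z.
Proof.
move=> h h'.
case: (pselect (forall x, hray dl x `<=` hray dl' x)) => [s|].
  left=> x; apply/seteqP; split=> // p xp.
  have [q [xq e]] := @ho_full _ h x _ (dist_ge0 x p).
  by rewrite -(beyond_inj h' (s _ _ xq) xp e).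
move/existsNP => [x /existsNP[p /not_implyP[xp np]]]; right.
have [q [xq dq]] := @ho_full _ h' x _ (dist_ge0 x p).
have [z [bp bq b]] := mt_med XT x p q; exists z.
have pz : p <> z.
  move=> e; apply: np; suff -> : p = q by [].
  subst z; apply: dist_le0; move: bq; rewrite /btw dq; oag.
have qz : q <> z.
  move=> e; apply: pz; subst z; apply/esym/dist_le0.
  by move: bp; rewrite /btw dq; oag.
have [_ zp] := beyond_btw h xp bp; have [_ zq] := beyond_btw h' xq bq.
have line p' q' : beyond dl z p' -> beyond dl' z q' -> btw p' z q'.
  move=> zp' zq'; have [r [pr p'r]] := ho_dir h p p'.
  have [t [qt q't]] := ho_dir h' q q'.
  have [_ b1] := beyond_trans h zp pr; have [_ b2] := beyond_trans h' zq qt.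
  have b3 := btw_extend qz b b2.
  have b4 := btwC (btw_extend pz (btwC b3) b1).
  have [_ b5] := beyond_trans h zp' p'r; have [_ b6] := beyond_trans h' zq' q't.
  have [_ b7] := btw_trans (btwC b5) b4.
  by have [_ /btwC] := btw_trans (btwC b6) (btwC b7).
move=> a; have [r [zr ar]] := ho_dir h z a; have [t [zt at']] := ho_dir h' z a.
have := line _ _ zr zt; have := dist_triangle r a t.
move: zr ar zt at'; rewrite /beyond /btw (distC r a) (distC r z) => *; oag.
Qed.

End Horo.

(** * Reduced paths in a simplicial tree *)

Section Walks.
Variable Y : graph.
Implicit Types (v w a b c m : vert Y) (e f : edge Y) (p q s : seq (edge Y)).

Definition revp p : seq (edge Y) := rev (map (@Defs.rev Y) p).

Lemma revp_rcons p e : revp (rcons p e) = erev e :: revp p.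
Proof. by rewrite /revp map_rcons rev_rcons. Qed.

Lemma revp_cons e p : revp (e :: p) = rcons (revp p) (erev e).
Proof. by rewrite /revp /= rev_cons. Qed.

Lemma size_revp p : size (revp p) = size p.
Proof. by rewrite /revp size_rev size_map. Qed.

Lemma revp_ends e p : exists q,
  revp (e :: p) = erev (last e p) :: q /\ last (erev (last e p)) q = erev e.
Proof.
elim/last_ind: p => [|p f _]; first by exists [::].
exists (revp (e :: p)).
by rewrite -rcons_cons revp_rcons last_rcons revp_cons last_rcons.
Qed.

Lemma walk_cat v p q w :
  walk v (p ++ q) w <-> exists m, walk v p m /\ walk m q w.
Proof.
elim: p v => [|e p IH] v /=; first by split=> [h|[m [-> //]]]; exists v.
split=> [[-> /IH[m [h1 h2]]]|[m [[-> h1] h2]]]; first by exists m.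
by split=> //; apply/IH; exists m.
Qed.

Lemma walk_end v p w w' : walk v p w -> walk v p w' -> w = w'.
Proof.
by elim: p v => [|e p IH] v /=; [move=> <- <-|move=> [_ h] [_ /(IH _ h)]].
Qed.

Lemma walk_rev v p w : walk v p w -> walk w (revp p) v.
Proof.
elim: p v => [|e p IH] v /=; first by move=> ->.
case=> <- /IH h; rewrite revp_cons -cats1; apply/walk_cat; exists (orig (erev e)).
by split=> //=; rewrite Defs.revK.
Qed.

Definition junction p q : Prop :=
  match p, q with e :: p', f :: _ => f <> erev (last e p') | _, _ => True end.

Lemma reduced_cat p q :
  reduced (p ++ q) <-> [/\ reduced p, reduced q & junction p q].
Proof.
elim: p => [|e p IH]; first by split=> [h|[]].
case: p IH => [|f p] IH /=.
  by case: q IH => [|f q] /= _; split=> [[h1 h2]|[h1 h2 h3]].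
by split=> [[h /IH[[h1 h2] h3 h4]]|[[h [h1 h2]] h3 h4]]; split=> //; apply/IH.
Qed.

Lemma reduced_revp p : reduced p -> reduced (revp p).
Proof.
elim: p => [|e p IH] //= [h /IH r]; rewrite revp_cons -cats1; apply/reduced_cat.
split=> //; case: p h {IH r} => [|f p] h //.
have [q [-> hl]] := revp_ends f p; rewrite /= hl => /esym E.
by apply: h; rewrite -E !Defs.revK.
Qed.

Lemma common_prefix p q : exists r p' q',
  [/\ p = r ++ p', q = r ++ q' &
      match p', q' with e :: _, f :: _ => e <> f | _, _ => True end].
Proof.
elim: p q => [|e p IH] q; first by exists [::], [::], q.
case: q => [|f q]; first by exists [::], (e :: p), [::].
have [<-|ne] := pselect (e = f); last by exists [::], (e :: p), (f :: q).
by have [r [p' [q' [-> -> h]]]] := IH q; exists (e :: r), p', q'.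
Qed.

Hypothesis YT : is_tree (full_subgraph Y).

Lemma pth_ex v w : exists p, [/\ walk v p w, reduced p &
  forall q, walk v q w -> reduced q -> q = p].
Proof.
have [_ /(_ v w I I) [p [[h1 h2 _] h3]]] := YT.
have eT q : edges_in (sge (full_subgraph Y)) q by elim: q => //= e q.
by exists p; split=> // q q1 q2; apply/esym/h3.
Qed.

Definition pth v w : seq (edge Y) := projT1 (cid (pth_ex v w)).

Lemma pth_walk v w : walk v (pth v w) w.
Proof. by rewrite /pth; case: cid => p []. Qed.

Lemma pth_red v w : reduced (pth v w).
Proof. by rewrite /pth; case: cid => p []. Qed.

Lemma pth_uniq v w p : walk v p w -> reduced p -> pth v w = p.
Proof. by rewrite /pth; case: cid => q [? ? h] /= h1 h2; apply/esym/h. Qed.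

Lemma pth_rev v w : pth w v = revp (pth v w).
Proof.
by apply: pth_uniq; [apply/walk_rev/pth_walk|apply/reduced_revp/pth_red].
Qed.

Lemma pth_nil v : pth v v = [::]. Proof. exact: pth_uniq. Qed.

Lemma pth_eq0 v w : pth v w = [::] -> v = w.
Proof. by have := pth_walk v w => /[swap] ->. Qed.

Lemma pth_edge e : pth (orig e) (orig (erev e)) = [:: e].
Proof. exact: pth_uniq. Qed.

Lemma pth_orig v w e p : pth v w = e :: p -> orig e = v.
Proof. by have := pth_walk v w => /[swap] -> []. Qed.

(** In a tree, [v] lies on the path from [a] to [b] when the paths from [v] to
    [a] and to [b] do not leave [v] by the same edge. *)
Definition btwv v a b : Prop :=
  match pth v a, pth v b with e :: _, f :: _ => e <> f | _, _ => True end.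

Lemma btwvC v a b : btwv v a b -> btwv v b a.
Proof. by rewrite /btwv; case: pth; case: pth => // *; apply: nesym. Qed.

Lemma pth_btw v a b : btwv v a b -> pth a b = revp (pth v a) ++ pth v b.
Proof.
move=> h; apply: pth_uniq.
  by apply/walk_cat; exists v; split; [apply/walk_rev|]; exact: pth_walk.
apply/reduced_cat; split; [exact/reduced_revp/pth_red|exact: pth_red|].
move: h; rewrite /btwv; case: (pth v a) => [//|e p].
have [q [-> hl]] := revp_ends e p; case: (pth v b) => [|f r] //=.
by rewrite hl Defs.revK => /nesym.
Qed.

Lemma not_btwv v a b : ~ btwv v a b ->
  exists e p q, pth v a = e :: p /\ pth v b = e :: q.
Proof.
rewrite /btwv; case: (pth v a) => [|e p]; first by case.
case: (pth v b) => [|f q]; first by case.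
by move/contrapT => <-; exists e, p, q.
Qed.

Definition nv a b : nat := size (pth a b).

Lemma nvC a b : nv a b = nv b a. Proof. by rewrite /nv pth_rev size_revp. Qed.

Lemma nvxx a : nv a a = 0%N. Proof. by rewrite /nv pth_nil. Qed.

Lemma nv_eq0 a b : nv a b = 0%N -> a = b.
Proof. by move/eqP/nilP; exact: pth_eq0. Qed.

Lemma nv_btw v a b : btwv v a b -> nv a b = (nv v a + nv v b)%N.
Proof. by move=> h; rewrite /nv (pth_btw h) size_cat size_revp. Qed.

Lemma pth_split a b p q : pth a b = p ++ q ->
  exists v, [/\ pth a v = p, pth v b = q & btwv v a b].
Proof.
move=> e; have := pth_walk a b; have := pth_red a b; rewrite e.
move=> /reduced_cat[rp rq j] /walk_cat[v [wp wq]]; exists v.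
have e1 : pth a v = p by exact: pth_uniq.
have e2 : pth v b = q by exact: pth_uniq.
split=> //; rewrite /btwv (pth_rev a v) e1 e2.
move: j; case: (p) => [|f p'] //; have [r [-> _]] := revp_ends f p'.
by case: (q) => //= *; apply: nesym.
Qed.

(** [m] is the end of the longest common prefix of the paths from [a] to [b] and
    to [c]. *)
Lemma medv a b c : exists m, [/\ btwv m a b, btwv m a c & btwv m b c].
Proof.
have [r [p [q [e1 e2 h]]]] := common_prefix (pth a b) (pth a c).
have [m [m1 m2 m3]] := pth_split e1; have [m' [m1' m2' m3']] := pth_split e2.
have e : m' = m.
  by apply: (walk_end (pth_walk a m')); rewrite m1' -m1; exact: pth_walk.
by rewrite {}e in m1' m2' m3'; exists m; split=> //; rewrite /btwv m2 m2'.
Qed.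

Lemma nv_triangle a b c : (nv a c <= nv a b + nv b c)%N.
Proof.
have [m [ab ac bc]] := medv a b c.
by rewrite (nv_btw ab) (nv_btw ac) (nv_btw bc); lia.
Qed.

(** The paths from [v] share their first edge, which the path from [a] to [b]
    avoids. *)
Lemma nv_same v a b : ~ btwv v a b -> (nv a b + 2 <= nv v a + nv v b)%N.
Proof.
move=> /not_btwv[e [p [q [ea eb]]]].
have [m [m1 m2 _]] := pth_split (p := [:: e]) ea.
have [m' [m1' m2' _]] := pth_split (p := [:: e]) eb.
have em : m' = m.
  by apply: (walk_end (pth_walk v m')); rewrite m1' -m1; exact: pth_walk.
rewrite {}em in m2'; have := nv_triangle a m b.
by rewrite (nvC a m) /nv m2 m2' ea eb /=; lia.
Qed.

Lemma nv_eq1 a b : nv a b = 1%N -> exists e,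
  [/\ pth a b = [:: e], orig e = a & orig (erev e) = b].
Proof.
rewrite /nv; have := pth_walk a b; case: (pth a b) => [|e [|f p]] //=.
by move=> [h1 h2] _; exists e.
Qed.

End Walks.

Lemma pth_map (Y : graph) (YT : is_tree (full_subgraph Y))
    (gv : vert Y -> vert Y) (ge : edge Y -> edge Y) (v w : vert Y) :
  injective ge -> (forall e, orig (ge e) = gv (orig e)) ->
  (forall e, erev (ge e) = ge (erev e)) ->
  pth YT (gv v) (gv w) = map ge (pth YT v w).
Proof.
move=> gi go gr; apply: pth_uniq.
  have := pth_walk YT v w; move: (pth YT v w) => p.
  elim: p v => [|e p IH] v /=; first by move=> ->.
  by move=> [<- /IH]; rewrite go gr go.
have := pth_red YT v w; elim: (pth YT v w) => [|e p IH] //= [h /IH r].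
by split=> //; case: p h {IH r} => // f p h; rewrite gr => /gi.
Qed.

(** * Trees of trees *)

Section LexPairs.
Variable L0 : oagType.
Implicit Types x y : lexZ L0.

Lemma lexP x y : x.1 = y.1 -> x.2 = y.2 -> x = y.
Proof. by case: x y => [a b] [c d] /= -> ->. Qed.

Lemma lex_le_lt x y : x.1 < y.1 -> x <= y.
Proof. by move=> h; rewrite lexZ_le h. Qed.

Lemma lex_le_eq x y : x.1 = y.1 -> x.2 <= y.2 -> x <= y.
Proof. by move=> h1 h2; rewrite lexZ_le h1 eqxx h2 orbT. Qed.

Lemma lexD1 x y : (x + y).1 = x.1 + y.1. Proof. by []. Qed.
Lemma lexD2 x y : (x + y).2 = x.2 + y.2. Proof. by []. Qed.
Lemma lexN1 x : (- x).1 = - x.1. Proof. by []. Qed.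
Definition inl0 (l : L0) : lexZ L0 := (0, l).

Lemma inl0D l m : inl0 (l + m) = inl0 l + inl0 m.
Proof. exact: lexP. Qed.

Lemma inl0_le l m : l <= m -> inl0 l <= inl0 m.
Proof. by move=> h; apply: lex_le_eq. Qed.

Lemma inl0_0 : inl0 0 = 0. Proof. by []. Qed.

Lemma inl0_inj : injective inl0. Proof. by move=> l m []. Qed.
End LexPairs.

Section TreeOfTrees.
Variables (L0 : oagType) (Y : graph) (YT : is_tree (full_subgraph Y)).
Variables (M : vert Y -> lmetric L0) (X : Type) (pi : X -> vert Y).
Variables (h : forall v, M v -> X) (fd : X -> X -> L0) (dl : edge Y -> X -> L0).
Hypothesis MT : forall v, mtree (M v).
Hypothesis M0 : forall v, inhabited (M v).
Hypothesis pi_h : forall v (a : M v), pi (h a) = v.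
Hypothesis h_surj : forall x, exists a : M (pi x), h a = x.
Hypothesis fd_h : forall v (a b : M v), fd (h a) (h b) = dist a b.
Hypothesis dl_horo : forall e v, orig e = v -> horo (fun a : M v => dl e (h a)).
Hypothesis dl_sep : forall e f v, e <> f -> orig e = v -> orig f = v ->
  exists z : M v, sep_at (fun a => dl e (h a)) (fun a => dl f (h a)) z.

Local Notation pth := (pth YT).
Local Notation btwv := (btwv YT).
Local Notation nv := (nv YT).

Lemma h_at v x : pi x = v -> exists a : M v, h a = x.
Proof. by move=> <-; exact: h_surj. Qed.

Lemma h_at2 x y : pi x = pi y -> exists v (a b : M v), h a = x /\ h b = y.
Proof.
move=> e; have [a ax] := h_at e; have [b yb] := h_surj y.
by exists (pi y), a, b.
Qed.

(** The maximum of [dl e + dl f] is attained along the line joining the ends of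
    [e] and [f]; its opposite is the length of that line, normalised by the two
    end maps. *)
Definition linelen (e f : edge Y) : L0 :=
  xget 0 [set l | exists x, [/\ pi x = orig e, l = - (dl e x + dl f x) &
    forall y, pi y = orig e -> dl e y + dl f y <= dl e x + dl f x]].

Lemma linelen_at e f x : pi x = orig e ->
  (forall y, pi y = orig e -> dl e y + dl f y <= dl e x + dl f x) ->
  linelen e f = - (dl e x + dl f x).
Proof.
move=> px hx; rewrite /linelen; case: xgetP => [l _ [x' [px' -> hx']]|]; last first.
  by move=> H; case: (H (- (dl e x + dl f x))); exists x.
by have := hx _ px'; have := hx' _ px; oag.
Qed.

Lemma linelenP e f v (z : M v) : orig e = v ->
  sep_at (fun a => dl e (h a)) (fun a => dl f (h a)) z ->
  linelen e f = - (dl e (h z) + dl f (h z)).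
Proof.
move=> ev hz; apply: linelen_at => [|y]; first by rewrite pi_h.
by rewrite ev => py; have [a <-] := h_at py; exact: hz.
Qed.

Lemma linelenC e f v : e <> f -> orig e = v -> orig f = v ->
  linelen e f = linelen f e.
Proof.
move=> ne ev fv; have [z hz] := dl_sep ne ev fv.
rewrite (linelenP ev hz) (@linelenP f e v z) //; first by rewrite addrC.
by move=> a; rewrite addrC [leRHS]addrC.
Qed.

Fixpoint pathlen (e : edge Y) (p : seq (edge Y)) : L0 :=
  if p is f :: p' then linelen (erev e) f + pathlen f p' else 0.

Lemma pathlen_cat e p f q :
  pathlen e (p ++ f :: q) =
  pathlen e p + linelen (erev (last e p)) f + pathlen f q.
Proof.
by elim: p e => [|g p IH] e /=; rewrite ?add0r // IH !addrA.
Qed.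

Definition pathlen' (s : seq (edge Y)) : L0 :=
  if s is e :: p then pathlen e p else 0.

Lemma pathlen_rev v s w : walk v s w -> reduced s ->
  pathlen' (revp s) = pathlen' s.
Proof.
elim: s v => [|e s IH] v //= [_ hs] [hr /(IH _ hs) {}IH].
case: s hs hr IH => [|f s] //= [fo hs] hr IH.
rewrite revp_cons -cats1; move: IH; have [q [-> hl]] := revp_ends f s.
rewrite /= => IH; rewrite pathlen_cat /= hl Defs.revK addr0 IH addrC.
by rewrite (@linelenC (erev e) f (orig f)) //; exact: nesym.
Qed.

(** The contribution to a distance from the origin of [e] of the part of the path
    beyond [e] when it ends at [x]. *)
Definition taillen e p x := pathlen e p - dl (erev (last e p)) x.

(** Along a path with edges e1, ..., en one crosses from the tree of [x] into the
    end of e1, runs along the line between the end of the reverse of e_i and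
    that of e_(i+1) in each tree passed, and leaves the end of the reverse of en.
    Each part is infinite, but end maps measure it up to constants that cancel
    across every edge. *)
Definition tdist2 x y : L0 :=
  if pth (pi x) (pi y) is e :: p then taillen e p y - dl e x else fd x y.

Definition tdist x y : lexZ L0 := ((nv (pi x) (pi y))%:Z, tdist2 x y).

Lemma tdist_fib x y : pi x = pi y -> tdist x y = inl0 (fd x y).
Proof. by move=> e; rewrite /tdist /tdist2 e nvxx pth_nil. Qed.

Lemma tdist_h v (a b : M v) : tdist (h a) (h b) = inl0 (dist a b).
Proof. by rewrite tdist_fib ?pi_h // fd_h. Qed.

Lemma tdistC x y : tdist x y = tdist y x.
Proof.
rewrite /tdist nvC /tdist2 (pth_rev YT (pi x) (pi y)).
have := pth_walk YT (pi x) (pi y); have := pth_red YT (pi x) (pi y).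
case E: (pth (pi x) (pi y)) => [|e p] hr hw.
  have [v [a [b [<- <-]]]] := h_at2 (pth_eq0 E).
  by rewrite !fd_h distC.
have W := pathlen_rev hw hr; move: W; have [q [-> hl]] := revp_ends e p.
by rewrite /taillen /= hl Defs.revK => ->; rewrite addrAC.
Qed.

Lemma tdist_to v (a : M v) x e p : pth v (pi x) = e :: p ->
  tdist x (h a) = ((nv v (pi x))%:Z, taillen e p x - dl e (h a)).
Proof. by move=> E; rewrite tdistC /tdist /tdist2 pi_h E. Qed.

(** The path from [pi x] to [pi y] is cut at [v] into two halves, joined in the
    tree at [v] by the line between the ends of their first edges. *)
Lemma tdist_cross v x y e p f q : btwv v (pi x) (pi y) ->
  pth v (pi x) = e :: p -> pth v (pi y) = f :: q ->
  tdist x y = ((nv v (pi x))%:Z + (nv v (pi y))%:Z,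
               taillen e p x + taillen f q y + linelen e f).
Proof.
move=> b ex ey; rewrite /tdist (nv_btw b) PoszD /tdist2 (pth_btw b) ex ey.
have W : pathlen' (revp (e :: p)) = pathlen e p.
  have := pathlen_rev (pth_walk YT v (pi x)) (pth_red YT v (pi x)).
  by rewrite ex.
have [r [er hl]] := revp_ends e p; rewrite er /= in W *.
congr pair; rewrite /taillen last_cat /= pathlen_cat hl Defs.revK W; oag.
Qed.

(** The trees [M v] are inhabited, so a witness that exists under a condition can
    be chosen unconditionally. *)
Lemma pick_M v (P : M v -> Prop) (Q : Prop) :
  (Q -> exists a, P a) -> exists a, Q -> P a.
Proof.
move=> QP; have [q|nq] := pselect Q; first by have [a Pa] := QP q; exists a.
by have [a] := M0 v; exists a.
Qed.

(** Seen from [v], a point lying beyond an edge e can be replaced by a point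
    of the tree at [v] far enough towards the end of e. For finitely many
    points this can be done simultaneously, so that the distances between
    points separated by [v] are computed in the tree at [v]. *)
Lemma shadow v (s : seq X) (u : seq (M v)) : exists r : X -> M v,
  [/\ forall x y, List.In x s -> List.In y s -> btwv v (pi x) (pi y) ->
        tdist x y =
        tdist x (h (r x)) + inl0 (dist (r x) (r y)) + tdist y (h (r y)),
      forall x, pi x = v -> h (r x) = x,
      forall x e p b, pth v (pi x) = e :: p -> List.In b u ->
        beyond (fun a => dl e (h a)) b (r x) &
      forall x y, ~ btwv v (pi x) (pi y) -> r x = r y].
Proof.
have /choice[base baseP] (x : X) : exists a : M v, pi x = v -> h a = x.
  by apply: pick_M => e; exact: h_at.
have /choice[zz zzP] (x : X * X) : exists z : M v, forall e p f q,
    pth v (pi x.1) = e :: p -> pth v (pi x.2) = f :: q -> e <> f ->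
    sep_at (fun a => dl e (h a)) (fun a => dl f (h a)) z.
  case E: (pth v (pi x.1)) => [|e p]; first by have [a] := M0 v; exists a.
  case F: (pth v (pi x.2)) => [|f q]; first by have [a] := M0 v; exists a.
  have [z hz] : exists z : M v, e <> f ->
      sep_at (fun a => dl e (h a)) (fun a => dl f (h a)) z.
    apply: pick_M => ne; apply: dl_sep => //; apply: pth_orig;
      [exact: E|exact: F].
  by exists z => _ _ _ _ [<- _] [<- _].
(* the shadows have to lie beyond the prescribed points, the points over v, and
   the lines joining the ends towards which shadows are taken *)
pose l := (u ++ List.map base s ++
  List.flat_map (fun x => List.map (fun y => zz (x, y)) s) s)%list.
have /choice[far farP] (e : edge Y) : exists p : M v, orig e = v ->
    forall b, List.In b l -> beyond (fun a => dl e (h a)) b p.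
  by apply: pick_M => ev; apply: ho_far => //; exact: dl_horo.
have lu b : List.In b u -> List.In b l.
  by move=> hb; apply/List.in_or_app; left.
have lb x : List.In x s -> List.In (base x) l.
  by move=> hx; apply/List.in_or_app; right; apply/List.in_or_app; left;
    exact: List.in_map.
have lz x y : List.In x s -> List.In y s -> List.In (zz (x, y)) l.
  move=> hx hy; apply/List.in_or_app; right; apply/List.in_or_app; right.
  apply/List.in_flat_map; exists x; split=> //.
  exact: (List.in_map (fun y => zz (x, y))).
pose r x := if pth v (pi x) is e :: _ then far e else base x.
have r0 x : pth v (pi x) = [::] -> r x = base x by rewrite /r => ->.
have r1 x e p : pth v (pi x) = e :: p -> r x = far e by rewrite /r => ->.
have hr x : pi x = v -> h (r x) = x.
  by move=> e; rewrite r0 ?baseP // e pth_nil.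
exists r; split=> //.
- have W x y f q : List.In x s -> pth v (pi x) = [::] -> pth v (pi y) = f :: q ->
      tdist x y =
      tdist x (h (r x)) + inl0 (dist (r x) (r y)) + tdist y (h (r y)).
    move=> xs Ex Ey; have e := esym (pth_eq0 Ex).
    have B := farP f (pth_orig Ey) _ (lb _ xs).
    rewrite -(r1 _ _ _ Ey) -r0 // /beyond in B.
    have z0 : tdist x (h (r x)) = 0 by rewrite -{1}(hr _ e) tdist_h distxx.
    have xy : tdist x y = tdist y (h (r x)) by rewrite (hr _ e) tdistC.
    by rewrite z0 xy !(tdist_to _ Ey) B; apply: lexP; rewrite /= ?add0r //; oag.
  move=> x y xs ys b; case Ex: (pth v (pi x)) => [|e p].
    case Ey: (pth v (pi y)) => [|f q]; last exact: W Ex Ey.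
    have ex := esym (pth_eq0 Ex); have ey := esym (pth_eq0 Ey).
    have z0 z : pi z = v -> tdist z (h (r z)) = 0.
      by move=> e; rewrite -{1}(hr _ e) tdist_h distxx.
    by rewrite !z0 // add0r addr0 -tdist_h !hr.
  case Ey: (pth v (pi y)) => [|f q].
    by rewrite tdistC (W _ _ _ _ ys Ey Ex) (distC (r y)) addrC addrA addrAC.
  have ne : e <> f by move: b; rewrite /btwv Ex Ey.
  have hz := zzP (x, y) _ _ _ _ Ex Ey ne.
  have B1 := farP e (pth_orig Ex) _ (lz _ _ xs ys).
  have B2 := farP f (pth_orig Ey) _ (lz _ _ xs ys).
  have ho1 := dl_horo (pth_orig Ex); have ho2 := dl_horo (pth_orig Ey).
  have := sep_line (MT v) ho1 ho2 hz B1 B2.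
  rewrite (tdist_cross b Ex Ey) (tdist_to _ Ex) (tdist_to _ Ey).
  rewrite (linelenP (pth_orig Ex) hz) -(r1 _ _ _ Ex) -(r1 _ _ _ Ey) in B1 B2 *.
  rewrite /beyond in B1 B2 => E; apply: lexP; rewrite /= ?addr0 //.
  by move: E; rewrite /btw (distC (r x)); oag.
- move=> x e p b Ex bu; rewrite (r1 _ _ _ Ex).
  exact: farP (pth_orig Ex) _ (lu _ bu).
move=> x y /not_btwv[e [p [q [Ex Ey]]]].
by rewrite (r1 _ _ _ Ex) (r1 _ _ _ Ey).
Qed.

Lemma tdist1 x y : (tdist x y).1 = (nv (pi x) (pi y))%:Z.
Proof. by []. Qed.

(** Let [m] be the median of the vertices of [x], [y], [z]. If [m] separates the
    vertex of [w] from the three others, the inequality is that of the shadows in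
    the tree at [m]. Otherwise two of the points have the same shadow, and an
    edge at [m] separates them from the other two; the sums of distances across
    this edge agree, and the remaining sum has a smaller first coordinate. *)
Lemma tdist_4pt x y z w :
  tdist x y + tdist z w <= tdist x z + tdist y w \/
  tdist x y + tdist z w <= tdist x w + tdist y z.
Proof.
have [m [xy xz yz]] := medv YT (pi x) (pi y) (pi z).
have [r [hr r0 r1 re]] := shadow (v := m) [:: x; y; z; w] [::].
have ix : List.In x [:: x; y; z; w] by left.
have iy : List.In y [:: x; y; z; w] by right; left.
have iz : List.In z [:: x; y; z; w] by right; right; left.
have iw : List.In w [:: x; y; z; w] by right; right; right; left.
pose through a b :=
  tdist a (h (r a)) + inl0 (dist (r a) (r b)) + tdist b (h (r b)).
have side a b c d : r a = r d -> tdist a b = through a b ->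
    tdist a c = through a c -> tdist b d = through b d ->
    tdist c d = through c d -> tdist a b + tdist c d = tdist a c + tdist b d.
  by move=> e -> -> -> ->; rewrite /through e (distC (r b)) (distC (r c)); oag.
(* w leaves m by a single edge, so m separates it from all but one of x, y, z *)
have cr a b c : btwv m (pi a) (pi b) -> btwv m (pi a) (pi c) ->
    btwv m (pi b) (pi c) -> ~ btwv m (pi a) (pi w) -> btwv m (pi b) (pi w).
  rewrite /btwv; case: (pth m (pi a)) => [|e p]; first by [].
  case: (pth m (pi w)) => [|f q]; first by [].
  by move=> + _ _ /contrapT <-; case: (pth m (pi b)) => // g t /nesym.
have sym := @btwvC _ YT m.
have [xw|nxw] := pselect (btwv m (pi x) (pi w)); last first.
  left; have yw := cr _ _ _ xy xz yz nxw.
  have zw := cr _ _ _ xz xy (sym _ _ yz) nxw.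
  have := side x y z w (re _ _ nxw) (hr x y ix iy xy) (hr x z ix iz xz).
  by move=> /(_ (hr y w iy iw yw) (hr z w iz iw zw)); oag.
have [yw|nyw] := pselect (btwv m (pi y) (pi w)); last first.
  right; have zw := cr _ _ _ yz (sym _ _ xy) (sym _ _ xz) nyw.
  have := side y x z w (re _ _ nyw) (hr y x iy ix (sym _ _ xy)) (hr y z iy iz yz).
  move=> /(_ (hr x w ix iw xw) (hr z w iz iw zw)).
  by have := tdistC x y; oag.
have [zw|nzw] := pselect (btwv m (pi z) (pi w)); last first.
  left; apply: lex_le_lt; rewrite !lexD1 !tdist1.
  rewrite (nv_btw xz) (nv_btw yw) (nv_btw xy); have := nv_same nzw; lia.
rewrite (hr x y) // (hr z w) // (hr x z) // (hr y w) // (hr x w) // (hr y z) //.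
case: (mt_4pt (MT m) (r x) (r y) (r z) (r w)) => /inl0_le;
  rewrite !inl0D => ?; [left|right]; oag.
Qed.

Lemma tdist_ge0 x y : 0 <= tdist x y.
Proof.
case E: (pth (pi x) (pi y)) => [|e p]; last first.
  by apply: lex_le_lt; rewrite tdist1 /nv E.
have [v [a [b [<- <-]]]] := h_at2 (pth_eq0 E).
by rewrite tdist_h; apply: inl0_le; exact: dist_ge0.
Qed.

Lemma tdist_eq0 x y : tdist x y = 0 <-> x = y.
Proof.
split=> [E|->]; last first.
  by have [b <-] := h_surj y; rewrite tdist_h distxx.
have /nv_eq0 e : nv (pi x) (pi y) = 0%N by move: (congr1 fst E) => [].
move: E; have [v [a [b [<- <-]]]] := h_at2 e.
by rewrite tdist_h => /inl0_inj /dist_eq0 ->.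
Qed.

Lemma tdist_triangle x y z : tdist x z <= tdist x y + tdist y z.
Proof.
have zz : tdist y y = 0 by apply/tdist_eq0.
have := tdistC y z.
by case: (tdist_4pt x z y y); rewrite zz; oag.
Qed.

Definition ttree : lmetric (lexZ L0) :=
  LMetric tdist_ge0 tdist_eq0 tdistC tdist_triangle.

(** An upper bound suffices to show that a point lies between two others, since
    the triangle inequality gives the opposite bound. *)
Lemma tdist_shadow v x (a : M v) (b : M v) :
  tdist x (h a) <= tdist x (h b) + inl0 (dist b a).
Proof. by rewrite -tdist_h; exact: tdist_triangle. Qed.

(** The first coordinate of [t] determines the vertex [v] over which the point
    lies. The shadows of [x] and [y] at [v] can be taken far enough out for the
    point sought to lie between them. *)
Lemma tdist_geod x y (t : lexZ L0) : 0 <= t <= tdist x y ->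
  exists z, tdist x z = t /\ tdist z y = tdist x y - t.
Proof.
move=> /andP[t0 tD].
have k0 : 0 <= t.1 by move: t0; rewrite lexZ_le => /orP[/ltW|/andP[/eqP <-]].
have kn : t.1 <= (nv (pi x) (pi y))%:Z.
  by move: tD; rewrite lexZ_le => /orP[/ltW|/andP[/eqP -> _]].
have [K eK] : exists K : nat, t.1 = K by exists `|t.1|%N; lia.
rewrite eK in k0 kn.
have [v [v1 v2 b]] := pth_split (esym (cat_take_drop K (pth (pi x) (pi y)))).
have n1 : nv v (pi x) = K.
  by rewrite nvC /nv v1 size_takel //; move: kn; rewrite /nv; lia.
have n2 : (nv v (pi y) + K = nv (pi x) (pi y))%N by rewrite (nv_btw b) n1 addnC.
pose bound x (l : L0) (u : M v) := forall e p, pth v (pi x) = e :: p ->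
  taillen e p x - dl e (h u) <= l.
have ex_bound z l : exists u, bound z l u.
  rewrite /bound; case E: (pth v (pi z)) => [|e p]; first by have [a] := M0 v; exists a.
  have [u hu] := ho_unbounded (taillen e p z - l) (dl_horo (pth_orig E)) (M0 v).
  by exists u => _ _ [<- <-]; move: hu; oag.
have [u1 hu1] := ex_bound x t.2; have [u2 hu2] := ex_bound y (tdist x y - t).2.
have [r [hr r0 r1 _]] := shadow (v := v) [:: x; y] [:: u1; u2].
have i1 : List.In u1 [:: u1; u2] by left.
have i2 : List.In u2 [:: u1; u2] by right; left.
have near z (l : lexZ L0) u : List.In u [:: u1; u2] -> bound z l.2 u -> 0 <= l ->
    l.1 = (nv v (pi z))%:Z -> tdist z (h (r z)) <= l.
  move=> iu hb l0 el; case E: (pth v (pi z)) => [|e p].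
    by rewrite (r0 _ (esym (pth_eq0 E))); have [_ ->] := tdist_eq0 z z.
  rewrite (tdist_to _ E); apply: lex_le_eq => //=.
  have := r1 _ _ _ _ E iu; have := hb _ _ E; rewrite /beyond.
  by have := dist_ge0 u (r z); oag.
have kx : tdist x (h (r x)) <= t by apply: (near _ _ u1) => //; rewrite n1 eK.
have ky : tdist y (h (r y)) <= tdist x y - t.
  apply: (near _ _ u2) => //; first by oag.
  by rewrite lexD1 lexN1 tdist1 eK -n2; lia.
have e := hr x y (or_introl erefl) (or_intror (or_introl erefl)) b.
have [s es] : exists s, t = tdist x (h (r x)) + inl0 s.
  exists (t.2 - (tdist x (h (r x))).2); apply: lexP.
    by rewrite lexD1 tdist1 pi_h nvC n1 eK addr0.
  by rewrite lexD2 /= addrC subrK.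
have inl0_le' l m : inl0 l <= inl0 m -> l <= m.
  by move=> H; rewrite oag_leNgt; apply/negP => lt; move: H; rewrite lexZ_le /= oag_leNgt lt.
have s0 : 0 <= s by apply: inl0_le'; rewrite inl0_0; oag.
have sd : s <= dist (r x) (r y) by apply: inl0_le'; oag.
have [|z [z1 z2]] := @mt_geod _ _ (MT v) (r x) (r y) s; first by rewrite s0.
have d1 := tdist_shadow x z (r x); have d2 := tdist_shadow y z (r y).
have := tdist_triangle x (h z) y; rewrite (distC (r y)) z2 z1 in d1 d2.
have e2 : inl0 (dist (r x) (r y)) = inl0 s + inl0 (dist (r x) (r y) - s).
  by rewrite -inl0D addrC subrK.
rewrite -z2 in e2 d2.
by have := tdistC (h z) y; exists (h z); oag.
Qed.

Lemma tdist_med x y z : exists m,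
  [/\ tdist x m + tdist m y = tdist x y, tdist x m + tdist m z = tdist x z &
      tdist y m + tdist m z = tdist y z].
Proof.
have [m [xy xz yz]] := medv YT (pi x) (pi y) (pi z).
have [r [hr _ _ _]] := shadow (v := m) [:: x; y; z] [::].
have [q [a b c]] := mt_med (MT m) (r x) (r y) (r z).
exists (h q).
have W u w : List.In u [:: x; y; z] -> List.In w [:: x; y; z] ->
    btwv m (pi u) (pi w) -> btw (r u) q (r w) ->
    tdist u (h q) + tdist (h q) w = tdist u w.
  move=> iu iw /(hr _ _ iu iw) E B.
  have := tdist_triangle u (h q) w; have := tdistC (h q) w.
  have := tdist_shadow u q (r u); have := tdist_shadow w q (r w).
  have : inl0 (dist (r u) (r w)) = inl0 (dist (r u) q) + inl0 (dist (r w) q).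
    by rewrite -inl0D (distC (r w)) B.
  by oag.
by split; apply: W => //; [left|right;left|left|right;right;left|right;left|right;right;left].
Qed.

Lemma ttree_mtree : mtree ttree.
Proof.
by split; [exact: tdist_geod|exact: tdist_4pt|exact: tdist_med].
Qed.

End TreeOfTrees.

(** * Affine automorphisms and rescaled trees *)

Section AutpTheory.
Variable L : oagType.
Implicit Types (f g : autp L) (x y : L).

Lemma autp0 f : f 0 = 0.
Proof. by apply: (addIr (f 0)); rewrite -autpD !add0r. Qed.

Lemma autpN f x : f (- x) = - f x.
Proof. by apply: (addIr (f x)); rewrite -autpD !addNr autp0. Qed.

Lemma autpMz f x m : f (x *~ m) = f x *~ m.
Proof.
have H n : f (x *+ n) = f x *+ n.
  by elim: n => [|n IH]; rewrite ?autp0 // !mulrS autpD IH.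
by case: m => n; [exact: H|rewrite !NegzE !mulrNz autpN -!pmulrn H].
Qed.

Lemma autp_oneE x : (1%g : autp L) x = x. Proof. by []. Qed.
Lemma autpVK f x : (f^-1)%g (f x) = x. Proof. exact: autp_funK. Qed.
Lemma autpKV f x : f ((f^-1)%g x) = x. Proof. exact: autp_invK. Qed.

Lemma autp_inj f : injective f. Proof. exact: can_inj (autpVK f). Qed.

Lemma autp_leE f x y : (f x <= f y) = (x <= y).
Proof.
apply/idP/idP => [|h]; last exact: autp_le.
by move/(autp_le (f^-1)%g); rewrite !autpVK.
Qed.
End AutpTheory.

Section Affine.
Variable L0 : oagType.

(** The semidirect product of [L0] by Aut^+(L0), which embeds in
    Aut^+(Z x L0). *)
Record aff := Aff { aff_th : autp L0; aff_mu : L0 }.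

HB.instance Definition _ := gen_eqMixin aff.
HB.instance Definition _ := gen_choiceMixin aff.

Definition aff_one := Aff 1%g 0.
Definition aff_mul (a b : aff) :=
  Aff (aff_th a * aff_th b)%g (aff_mu a + aff_th a (aff_mu b)).
Definition aff_inv (a : aff) :=
  Aff (aff_th a)^-1%g (- (aff_th a)^-1%g (aff_mu a)).

Lemma affP a b : aff_th a = aff_th b -> aff_mu a = aff_mu b -> a = b.
Proof. by case: a b => [t m] [t' m'] /= -> ->. Qed.

Fact aff_mulA : associative aff_mul.
Proof.
by move=> a b c; apply: affP => /=; [rewrite mulgA|rewrite autpD addrA].
Qed.
Fact aff_mul1 : left_id aff_one aff_mul.
Proof. by move=> a; apply: affP => /=; [rewrite mul1g|rewrite add0r]. Qed.
Fact aff_mulr1 : right_id aff_one aff_mul.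
Proof. by move=> a; apply: affP => /=; [rewrite mulg1|rewrite autp0 addr0]. Qed.
Fact aff_mulV : left_inverse aff_one aff_inv aff_mul.
Proof. by move=> a; apply: affP => /=; [rewrite mulVg|rewrite addNr]. Qed.
Fact aff_mulrV : right_inverse aff_one aff_inv aff_mul.
Proof.
by move=> a; apply: affP => /=; [rewrite mulgV|rewrite autpN autpKV addrN].
Qed.

HB.instance Definition _ := isGroup.Build aff
  aff_mulA aff_mul1 aff_mulr1 aff_mulV aff_mulrV.

Definition aff_lex_fun (a : aff) (x : lexZ L0) : lexZ L0 :=
  (x.1, aff_th a x.2 + aff_mu a *~ x.1).

Lemma aff_lexM a b x : aff_lex_fun (a * b)%g x = aff_lex_fun a (aff_lex_fun b x).
Proof.
apply: lexP => //=; rewrite autpD autpMz mulrzDl -!addrA; congr (_ + _).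
by rewrite addrC.
Qed.

Lemma aff_lex1 x : aff_lex_fun 1%g x = x.
Proof. by apply: lexP => //=; rewrite mul0rz addr0. Qed.

Fact aff_lexD a : {morph aff_lex_fun a : x y / x + y}.
Proof.
by move=> x y; apply: lexP => //=; rewrite autpD mulrzDr addrACA.
Qed.

Fact aff_lex_le a : {homo aff_lex_fun a : x y / x <= y}.
Proof.
move=> x y; rewrite !lexZ_le /= => /orP[->//|/andP[/eqP e h]].
by rewrite e eqxx /=; apply/orP; right; rewrite oag_leD2 ?autp_le.
Qed.

Fact aff_lexK a : cancel (aff_lex_fun a) (aff_lex_fun a^-1%g).
Proof. by move=> x; rewrite -aff_lexM mulVg aff_lex1. Qed.

Fact aff_lexVK a : cancel (aff_lex_fun a^-1%g) (aff_lex_fun a).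
Proof. by move=> x; rewrite -aff_lexM mulgV aff_lex1. Qed.

Definition aff_lex (a : aff) : autp (lexZ L0) :=
  Autp (@aff_lexD a) (@aff_lex_le a) (@aff_lexK a) (@aff_lexVK a).

Fact aff_lex_is_mul : {morph aff_lex : a b / (a * b)%g}.
Proof. by move=> a b; apply: autpP => x; exact: aff_lexM. Qed.

HB.instance Definition _ :=
  isMultiplicative.Build aff (autp (lexZ L0)) aff_lex aff_lex_is_mul.
End Affine.

Section Scale.
Variables (L : oagType) (t : autp L) (M : lmetric L).

Definition sdist (x y : M) : L := t (dist x y).

Fact sdist_ge0 x y : 0 <= sdist x y.
Proof. by rewrite /sdist -(autp0 t) autp_leE dist_ge0. Qed.
Fact sdist_eq0 x y : sdist x y = 0 <-> x = y.
Proof.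
rewrite /sdist -(autp0 t); split; first by move/autp_inj/dist_eq0.
by move/dist_eq0 ->.
Qed.
Fact sdistC x y : sdist x y = sdist y x. Proof. by rewrite /sdist distC. Qed.
Fact sdist_triangle x y z : sdist x z <= sdist x y + sdist y z.
Proof. by rewrite /sdist -autpD autp_leE dist_triangle. Qed.

Definition scale : lmetric L :=
  LMetric sdist_ge0 sdist_eq0 sdistC sdist_triangle.

Lemma scale_mtree : mtree M -> mtree scale.
Proof.
move=> [h1 h2 h3]; split.
- move=> x y l /andP[l0 l1].
  have [|z [xz zy]] := h1 x y ((t^-1)%g l).
    by rewrite -(autp_leE t) autp0 autpKV l0 -(autp_leE t) autpKV l1.
  by exists z; rewrite /= /sdist xz zy autpD autpN autpKV.
- move=> x y z w; rewrite /= /sdist -!autpD.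
  by rewrite !autp_leE; exact: h2.
move=> x y z; have [m [b1 b2 b3]] := h3 x y z; exists m.
by rewrite /btw /= /sdist -!autpD b1 b2 b3.
Qed.
End Scale.

(** End maps are determined by their end up to a constant, and are rescaled with
    the metric. *)
Lemma horo_transport (L : oagType) (M N : lmetric L) (t : autp L) (c : L)
    (f : M -> N) (g : N -> M) (dl : N -> L) : cancel f g -> cancel g f ->
  (forall a b, dist a b = t (dist (f a) (f b))) ->
  horo dl -> horo (fun a => t (dl (f a)) + c).
Proof.
move=> fK gK fd h.
have B a b : beyond dl (f a) (f b) -> beyond (fun a => t (dl (f a)) + c) a b.
  by rewrite /beyond fd => ->; rewrite autpD addrAC.
split=> [x y|x l l0].
  have [p [xp yp]] := ho_dir h (f x) (f y).
  by exists (g p); split; apply: B; rewrite gK.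
have [|p [xp dp]] := @ho_full _ _ _ h (f x) ((t^-1)%g l).
  by rewrite -(autp_leE t) autp0 autpKV.
by exists (g p); split; [apply: B|rewrite fd]; rewrite gK // dp autpKV.
Qed.

Lemma mult1 (G H : groupType) (f : {multiplicative G -> H}) : f 1%g = 1%g.
Proof. by apply: (@mulgI _ (f 1%g)); rewrite -gmulfM !mulg1. Qed.

Lemma inj_surj_bij (S T : Type) (f : S -> T) :
  injective f -> (forall y, exists x, f x = y) -> bijective f.
Proof.
move=> fi /choice[g gK]; exists g => // x; exact: fi.
Qed.

(** * The action on the tree of trees over the Bass-Serre tree *)

Section Model.
Variables (L0 : oagType) (GG : graph_of_groups) (B : bass_serre GG).
Variable D : sig_data L0 GG.
Hypotheses (c1 : C1 D) (c2 : C2 D) (c3 : C3 B D) (c4 : C4 B D) (c5 : C5 B D).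

Local Notation Y := (gg_graph GG).
Local Notation V := (vert (bsX B)).
Local Notation lift := (liftv B).
Local Notation inc := (incl B).
Local Notation av := (@actv GG B).
Local Notation ae := (@acte GG B).
Implicit Types (g k t : pi1 B) (v w : V) (x y : vert Y).

Lemma av1 v : av 1%g v = v. Proof. by case: (actv_action B). Qed.
Lemma avM g k v : av (g * k)%g v = av g (av k v).
Proof. by case: (actv_action B). Qed.
Lemma ae1 e : ae 1%g e = e. Proof. by case: (acte_action B). Qed.
Lemma aeM g k e : ae (g * k)%g e = ae g (ae k e).
Proof. by case: (acte_action B). Qed.

Lemma ae_inj g : injective (ae g).
Proof. by move=> e f /(congr1 (ae g^-1%g)); rewrite -!aeM mulVg !ae1. Qed.

(** ** The linear and translation parts of the fundamental group *)

Definition vaff x (s : VG x) : aff L0 := Aff (thV D x s) (muV D x s).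

Fact vaff_mul x : {morph @vaff x : r s / (r * s)%g}.
Proof.
move=> r s; apply: affP => /=; first exact: gmulfM.
by case: c4 => _ h _; exact: h.
Qed.

HB.instance Definition _ x :=
  isMultiplicative.Build (VG x) (aff L0) (@vaff x) (@vaff_mul x).

(** [C3] and [C4] are the relations of the fundamental group, read in the linear and
    in the translation parts. *)
Lemma pi1_aff : exists k : {multiplicative pi1 B -> aff L0},
  (forall x s, k (inc x s) = vaff s) /\
  (forall e, k (gE B e) = Aff (thE D e) (muE D e)).
Proof.
apply: (@pi1_univ _ B (aff L0) (fun x => @vaff x)
          (fun e => Aff (thE D e) (muE D e))).
split=> [e s|e /(pi1_rel B).2 he]; last first.
  by case: c3 c4 => _ h [_ _ h']; apply: affP; [exact: h|exact: h'].
have [h1 _] := c3; have [h2 _ _] := c4.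
have H e' (r : EG e'.1) : aff_mu (Aff (thE D e') (muE D e') *
     vaff (alpha e' r) * (Aff (thE D e') (muE D e'))^-1)%g =
     mu_alpha D (e := absE B e') r.
  by rewrite -h2 /= !autpN.
apply: affP; first exact: h1.
by rewrite (H e) (H (erev e)).
Qed.

Definition kaff := projT1 (cid pi1_aff).
Definition theta g := aff_th (kaff g).
Definition mu g := aff_mu (kaff g).

Lemma thetaM g k : theta (g * k)%g = (theta g * theta k)%g.
Proof. by rewrite /theta gmulfM. Qed.
Lemma muM g k : mu (g * k)%g = mu g + theta g (mu k).
Proof. by rewrite /mu gmulfM. Qed.
Lemma thetaE g k l : theta (g * k)%g l = theta g (theta k l).
Proof. by rewrite thetaM. Qed.
Lemma theta1 : theta 1%g = 1%g. Proof. by rewrite /theta mult1. Qed.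
Lemma theta_inc x s : theta (inc x s) = thV D x s.
Proof. by rewrite /theta /kaff; case: cid => k /= [-> _]. Qed.
Lemma mu_inc x s : mu (inc x s) = muV D x s.
Proof. by rewrite /mu /kaff; case: cid => k /= [-> _]. Qed.
Lemma theta_gE e : theta (gE B e) = thE D e.
Proof. by rewrite /theta /kaff; case: cid => k /= [_ ->]. Qed.
Lemma mu_gE e : mu (gE B e) = muE D e.
Proof. by rewrite /mu /kaff; case: cid => k /= [_ ->]. Qed.

(** ** The points of the tree *)

Lemma quov_av g v : quov (av g v) = quov v.
Proof. by apply/esym/quovP; exists g. Qed.

Lemma sec_ex v : exists g, av g (lift (quov v)) = v.
Proof.
have /quovP[g e] : quov (lift (quov v)) = quov v by rewrite liftvK.
by exists g.
Qed.

Definition sec v : pi1 B := projT1 (cid (sec_ex v)).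
Lemma secP v x : quov v = x -> av (sec v) (lift x) = v.
Proof. by move=> <-; rewrite /sec; case: cid. Qed.

Lemma quo_cls x g : quov (av g (lift x)) = x.
Proof. by rewrite quov_av liftvK. Qed.

Lemma stab_inc x g k : av g (lift x) = av k (lift x) ->
  exists s : VG x, g = (k * inc x s)%g.
Proof.
move=> e; have : av (k^-1 * g)%g (lift x) = lift x.
  by rewrite avM e -avM mulVg av1.
by move/stabvP=> [s _ es]; exists s; rewrite es mulVKg.
Qed.

Lemma stabx_ex x g : exists s : VG x, g = (sec (av g (lift x)) * inc x s)%g.
Proof. by apply: stab_inc; rewrite secP // quo_cls. Qed.

Definition stabx x g : VG x := projT1 (cid (stabx_ex x g)).
Lemma stabxP x g : g = (sec (av g (lift x)) * inc x (stabx x g))%g.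
Proof. by rewrite /stabx; case: cid. Qed.

(** A point is a vertex of the Bass-Serre tree together with a point of the tree
    given for its orbit; [cls x g a] is the class of (g, a) in the quotient of
    the product of the group and the tree at x by the vertex group at x. *)
Definition pt := {x : vert Y & ({v : V | quov v = x} * trX D x)%type}.

Definition cls x g (a : trX D x) : pt :=
  existT _ x (exist _ (av g (lift x)) (quo_cls x g), trA D x (stabx x g) a).

Definition pv (p : pt) : V := sval (projT2 p).1.

Lemma pv_cls x g a : pv (cls (x := x) g a) = av g (lift x). Proof. by []. Qed.

Lemma trA1 x a : trA D x 1%g a = a. Proof. by case: (trA_action D x). Qed.
Lemma trAM x r s a : trA D x (r * s)%g a = trA D x r (trA D x s a).
Proof. by case: (trA_action D x). Qed.
Lemma trAK x s a : trA D x s^-1%g (trA D x s a) = a.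
Proof. by rewrite -trAM mulVg trA1. Qed.
Lemma trAVK x s a : trA D x s (trA D x s^-1%g a) = a.
Proof. by rewrite -trAM mulgV trA1. Qed.

Lemma pt_eq x v w (hv : quov v = x) (hw : quov w = x) (a b : trX D x) :
  v = w -> a = b ->
  existT _ x (exist _ v hv, a) = existT _ x (exist _ w hw, b) :> pt.
Proof. by move=> e ->; subst w; rewrite (Prop_irrelevance hv hw). Qed.

Lemma clsM x g s a : cls (x := x) (g * inc x s)%g a = cls g (trA D x s a).
Proof.
have e : av (g * inc x s)%g (lift x) = av g (lift x).
  by rewrite avM; congr av; apply/stabvP; exists s.
apply: pt_eq => //; rewrite -trAM; congr trA.
apply: (incl_inj (b := B)); rewrite gmulfM.
have h1 := stabxP x g; have := stabxP x (g * inc x s)%g; rewrite e.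
by rewrite {1}h1 -mulgA => /(can_inj (mulKg _)) ->.
Qed.

Lemma cls_eq x g k a b : cls (x := x) g a = cls k b ->
  exists s, g = (k * inc x s)%g /\ b = trA D x s a.
Proof.
move=> E; have e : av g (lift x) = av k (lift x) by exact: (congr1 pv E).
have [s es] := stab_inc e; exists s; split=> //.
move: E; rewrite es clsM => /(@Eqdep.EqdepTheory.inj_pair2 _ _ _ _ _) [].
by move/(congr1 (trA D x (stabx x k)^-1%g)); rewrite !trAK.
Qed.

Lemma cls_x x y g k a b : cls (x := x) g a = cls (x := y) k b -> x = y.
Proof. by move/(congr1 (@projT1 _ _)). Qed.

Lemma cls_inj x g : injective (cls (x := x) g).
Proof.
move=> a b /cls_eq[s []]; rewrite -{1}[g]mulg1 => /(can_inj (mulKg _)).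
by rewrite -(mult1 (inc x)) => /(incl_inj (b := B)) <- ->; rewrite trA1.
Qed.

Lemma cls_at p x g : pv p = av g (lift x) -> exists a, p = cls (x := x) g a.
Proof.
case: p => y [[v hv] b]; rewrite /pv /= => e.
have xy : y = x by rewrite -hv e quo_cls.
move: hv b; rewrite xy => hv b; exists (trA D x (stabx x g)^-1%g b).
by apply: pt_eq => //; rewrite trAVK.
Qed.

Definition pact g (p : pt) : pt :=
  let: existT x (v, a) := p in cls (x := x) (g * sec (sval v))%g a.

Lemma pact_cls g x k a : pact g (cls (x := x) k a) = cls (g * k)%g a.
Proof. by rewrite /= -clsM -mulgA -stabxP. Qed.

Lemma pt_cls p : exists x g a, p = cls (x := x) g a.
Proof.
have [a ->] := @cls_at p _ _ (esym (secP (erefl (quov (pv p))))).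
by eexists; eexists; eexists; reflexivity.
Qed.

Lemma pact_action : is_action pact.
Proof.
split=> [p|g k p]; have [x [t [a ->]]] := pt_cls p.
  by rewrite pact_cls mul1g.
by rewrite !pact_cls mulgA.
Qed.

Lemma pact1 p : pact 1%g p = p. Proof. by case: pact_action. Qed.
Lemma pactM g k p : pact (g * k)%g p = pact g (pact k p).
Proof. by case: pact_action. Qed.

Lemma pv_pact g p : pv (pact g p) = av g (pv p).
Proof. by have [x [t [a ->]]] := pt_cls p; rewrite pact_cls !pv_cls avM. Qed.

(** The distance inside a fibre is read off any common representative [g], with
    the metric rescaled by [theta g]; it is well defined as the vertex groups act
    affinely. *)
Definition fdist (p q : pt) : L0 :=
  xget 0 [set l | exists x g a b,
    [/\ p = cls (x := x) g a, q = cls g b & l = theta g (dist a b)]].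

Lemma fdist_cls x g a b : fdist (cls (x := x) g a) (cls g b) = theta g (dist a b).
Proof.
rewrite /fdist; case: xgetP => [l _ [y [k [a' [b' [ea eb ->]]]]]|]; last first.
  by move=> H; case: (H (theta g (dist a b))); exists x, g, a, b.
have e := cls_x ea; subst y.
have [s [es ->]] := cls_eq ea; have [r [er ->]] := cls_eq eb.
have -> : r = s.
  by apply: (incl_inj (b := B)); apply: (can_inj (mulKg k)); rewrite -es -er.
by rewrite trA_affine es thetaE theta_inc.
Qed.

Lemma trX_mtree x : mtree (trX D x).
Proof. exact/ltree_mtree/trX_tree. Qed.

Lemma trX_inh x : inhabited (trX D x).
Proof. by case: (trX_tree D x). Qed.

(** Rescaling makes the charts isometric. *)
Definition treeat v : lmetric L0 := scale (theta (sec v)) (trX D (quov v)).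
Definition chart v (a : treeat v) : pt := cls (sec v) a.

Lemma pv_chart v a : pv (chart (v := v) a) = v.
Proof. by rewrite /chart pv_cls secP. Qed.

Lemma chart_surj p : exists a : treeat (pv p), chart a = p.
Proof.
have [a ea] := @cls_at p _ _ (esym (secP (erefl (quov (pv p))))).
by exists a; exact: (esym ea).
Qed.

Lemma fdist_chart v (a b : treeat v) : fdist (chart a) (chart b) = dist a b.
Proof. by rewrite fdist_cls. Qed.

(** ** End maps for the edges of the Bass-Serre tree *)

Lemma lifte_rev e : lifte B (erev e) = erev (lifte B e).
Proof.
have : sge (bsS B) (erev (lifte B e)) by apply: sg_rev; rewrite bsSe; exists e.
rewrite bsSe => -[f _ ef]; rewrite -ef; congr lifte.
by rewrite -(lifteK B f) ef quo_rev lifteK.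
Qed.

Lemma quoe_ae g e : quoe (ae g e) = quoe e.
Proof. by apply/esym/quoeP; exists g. Qed.

Lemma tau_ex (e : edge (bsX B)) :
  exists t, ae t (lifte B (quoe e)) = e.
Proof.
have /quoeP[g E] : quoe (lifte B (quoe e)) = quoe e by rewrite lifteK.
by exists g.
Qed.

Definition tau0 e : pi1 B := projT1 (cid (tau_ex e)).

(** An element carrying the edge of S* in the orbit of [e] to [e], the same for
    both orientations of [e]. *)
Definition tau (e : edge (bsX B)) : pi1 B :=
  if (quoe e).2 then tau0 e else tau0 (erev e).

Lemma tauP e : ae (tau e) (lifte B (quoe e)) = e.
Proof.
rewrite /tau /tau0; case: ifP => _; case: cid => t //=.
by rewrite quo_rev lifte_rev -act_rev => /(congr1 (@Defs.rev _)); rewrite !Defs.revK.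
Qed.

Lemma quoe_rev2 (e : edge (bsX B)) : (quoe (erev e)).2 = ~~ (quoe e).2.
Proof. by rewrite quo_rev. Qed.

Lemma tau_rev e : tau (erev e) = tau e.
Proof. by rewrite /tau quoe_rev2 Defs.revK; case: (quoe e).2. Qed.

Lemma orig_lift t e : orig (ae t (lifte B e)) = av (t * gE B e)%g (lift (orig e)).
Proof. by rewrite act_orig avM -(gEP B e) -(avM (gE B e)) mulgV av1. Qed.

(** The end map of the edge [e], transported by [tau e]. The translation part of
    [tau e] is attributed to one orientation of [e], since only the sum of the
    end maps of [e] and of its reverse is prescribed. *)
Definition edl e (p : pt) : L0 :=
  xget 0 [set l | exists a : trX D (orig (quoe e)),
    p = cls (tau e * gE B (quoe e))%g a /\
    l = theta (tau e * gE B (quoe e))%g (dlt D (quoe e) a)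
        + (if (quoe e).2 then - mu (tau e) else 0)].

Lemma edl_cls e f (a : trX D (orig f)) : quoe e = f ->
  edl e (cls (tau e * gE B f)%g a) = theta (tau e * gE B f)%g (dlt D f a)
        + (if f.2 then - mu (tau e) else 0).
Proof.
move=> ef; subst f; rewrite /edl; case: xgetP => [l _ [b [/cls_inj <- //]]|].
by move=> H; case: (H _ (ex_intro _ a (conj erefl erefl))).
Qed.

Lemma mu_edge_stab (f : edge Y) (s : EG f.1) :
  mu (gE B f * inc (orig f) (alpha f s) * (gE B f)^-1)%g
  = mu_alpha D (e := absE B f) s.
Proof.
have [<- _ _] := c4; rewrite /mu !gmulfM.
have -> : kaff (gE B f)^-1%g = (kaff (gE B f))^-1%g.
  by apply: (@mulgI _ (kaff (gE B f))); rewrite -gmulfM !mulgV mult1.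
have -> : kaff (gE B f) = Aff (thE D f) (muE D f).
  by apply: affP; [exact: theta_gE|exact: mu_gE].
have -> : kaff (inc (orig f) (alpha f s)) = vaff (alpha f s).
  by apply: affP; [exact: theta_inc|exact: mu_inc].
by rewrite /= !autpN.
Qed.

(** For [t = tau e] this is the definition of [edl]. Any other [t] differs from it
    by an element of the stabiliser of the edge, and [C5] says that the right-hand
    side is the same for both. *)
Lemma edl_sum (t : pi1 B) (f : edge Y) a b :
  edl (ae t (lifte B f)) (cls (t * gE B f)%g a) +
  edl (erev (ae t (lifte B f))) (cls (t * gE B (erev f))%g b) =
  theta t (thE D f (dlt D f a) + thE D (erev f) (dlt D (erev f) b)) - mu t.
Proof.
set e := ae t (lifte B f).
have qe : quoe e = f by rewrite /e quoe_ae lifteK.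
have qre : quoe (erev e) = erev f by rewrite quo_rev qe.
have [s es] : exists s : EG f.1,
    ((tau e)^-1 * t)%g = (gE B f * inc (orig f) (alpha f s) * (gE B f)^-1)%g.
  have te : ae (tau e) (lifte B f) = e by have := tauP e; rewrite qe.
  by apply/stabeP; rewrite aeM -/e -[X in ae _ X]te -aeM mulVg ae1.
have es' : ((tau e)^-1 * t)%g =
    (gE B (erev f) * inc (orig (erev f)) (alpha (erev f) s) * (gE B (erev f))^-1)%g.
  by rewrite es (pi1_rel B).1.
have et : t = (tau e * ((tau e)^-1 * t))%g by rewrite mulVKg.
move: ((tau e)^-1 * t)%g es es' et => w es es' et.
have e1 : (t * gE B f)%g = (tau e * gE B f * inc (orig f) (alpha f s))%g.
  by rewrite {1}et es -!mulgA mulVg mulg1.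
have e2 : (t * gE B (erev f))%g =
    (tau e * gE B (erev f) * inc (orig (erev f)) (alpha (erev f) s))%g.
  by rewrite {1}et es' -!mulgA mulVg mulg1.
rewrite e1 e2 !clsM (edl_cls _ qe) -(tau_rev e) (edl_cls _ qre) tau_rev.
have mw : mu w = mu_alpha D (e := absE B f) s by rewrite es mu_edge_stab.
have w1 l : theta w (thE D f l) = thE D f (thV D (orig f) (alpha f s) l).
  by rewrite -theta_gE -theta_inc -!thetaE es -!mulgA mulVg mulg1.
have w2 l : theta w (thE D (erev f) l) =
    thE D (erev f) (thV D (orig (erev f)) (alpha (erev f) s) l).
  by rewrite -theta_gE -theta_inc -!thetaE es' -!mulgA mulVg mulg1.
rewrite {1 2}et muM !thetaE mw !theta_gE autpD w1 w2.
rewrite -(c5 s a b) /th_alpha !autpD !autpN.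
have : (if f.2 then - mu (tau e) else 0) +
    (if (erev f).2 then - mu (tau e) else 0) = - mu (tau e).
  have -> : (erev f).2 = ~~ f.2 by [].
  by case: f.2; rewrite /= ?addr0 ?add0r.
by oag.
Qed.

Lemma pt_over v : exists p, pv p = v.
Proof. by have [a] := trX_inh (quov v); exists (@chart v a); exact: pv_chart. Qed.

Lemma edl_at e p : pv p = orig e -> exists a : trX D (orig (quoe e)),
  p = cls (tau e * gE B (quoe e))%g a.
Proof. by move=> h; apply: cls_at; rewrite h -orig_lift tauP. Qed.

Lemma edl_sumM g e p q : pv p = orig e -> pv q = orig (erev e) ->
  edl (ae g e) (pact g p) + edl (erev (ae g e)) (pact g q) =
  theta g (edl e p + edl (erev e) q) - mu g.
Proof.
move=> hp hq; have [a ->] := edl_at hp.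
have te := tauP e.
have [b ->] : exists b : trX D (orig (erev (quoe e))),
    q = cls (tau e * gE B (erev (quoe e)))%g b.
  by apply: (@cls_at q (orig (erev (quoe e)))); rewrite hq -orig_lift lifte_rev -act_rev te.
rewrite !pact_cls !mulgA.
have := edl_sum (tau e) a b; have := edl_sum (g * tau e)%g a b.
by rewrite aeM te => -> ->; rewrite thetaE muM [X in _ = X - _](autpD (theta g)) autpN; oag.
Qed.

(** Varying one of the two points in [edl_sumM] shows that each end map alone is
    equivariant up to a constant. *)
Lemma edl_equiv g : exists kap : edge (bsX B) -> L0,
  (forall e p, pv p = orig e ->
     edl (ae g e) (pact g p) = theta g (edl e p) + kap e) /\
  (forall e, kap e + kap (erev e) = - mu g).
Proof.
have /choice[p0 hp0] := pt_over.
exists (fun e => edl (ae g e) (pact g (p0 (orig e))) - theta g (edl e (p0 (orig e)))).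
split=> [e p hp|e].
  have := edl_sumM g hp (hp0 (orig (erev e))).
  by have := edl_sumM g (hp0 (orig e)) (hp0 (orig (erev e))); rewrite !autpD; oag.
have := edl_sumM g (hp0 (orig e)) (hp0 (orig (erev e))).
by rewrite -act_rev autpD; oag.
Qed.

Lemma edl_const t (f : edge Y) : exists c, forall a,
  edl (ae t (lifte B f)) (cls (t * gE B f)%g a) =
  theta (t * gE B f)%g (dlt D f a) + c.
Proof.
have [b] := trX_inh (orig (erev f)); have [a0] := trX_inh (orig f).
exists (edl (ae t (lifte B f)) (cls (t * gE B f)%g a0) -
        theta (t * gE B f)%g (dlt D f a0)) => a.
have := edl_sum t a b; have := edl_sum t a0 b.
by rewrite !thetaE !theta_gE !autpD; oag.
Qed.

Lemma dlt_horo (f : edge Y) : horo (dlt D f) /\ eps D f = hclass (dlt D f).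
Proof.
have [ft _] := c1 f.
apply: end_horo; [exact: trX_mtree|exact: epsP|exact: ft|exact: dltP].
Qed.

Lemma edl_horo_lift t (f : edge Y) y g : av g (lift y) = orig (ae t (lifte B f)) ->
  horo (fun a : scale (theta g) (trX D y) => edl (ae t (lifte B f)) (cls g a)).
Proof.
rewrite orig_lift => eg.
have ey : y = orig f by rewrite -(quo_cls y g) eg quo_cls.
subst y; have [c hc] := edl_const t f; have [s es] := stab_inc eg.
pose N : lmetric L0 := trX D (orig f).
have -> : (fun a : scale (theta g) (trX D (orig f)) =>
             edl (ae t (lifte B f)) (cls g a)) =
    (fun a => theta (t * gE B f)%g (dlt D f (trA D _ s a)) + c).
  by apply/funext => a; rewrite es clsM hc.
apply: (@horo_transport _ (scale (theta g) (trX D (orig f))) (trX D (orig f))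
    (theta (t * gE B f)%g) c (trA D _ s) (trA D _ s^-1%g)).
- exact: trAK.
- exact: trAVK.
- by move=> a b; rewrite /= /sdist trA_affine es thetaE theta_inc.
by have [] := dlt_horo f.
Qed.

Lemma edl_horo e v : orig e = v -> horo (fun a : treeat v => edl e (chart a)).
Proof.
by rewrite -{1 2}(tauP e) => ev; apply: edl_horo_lift; rewrite secP.
Qed.

(** The end at the origin of [e] as a class of rays in the whole tree. It does not
    refer to a representative of [e], so that ends coming from different
    representatives can be compared. *)
Definition xclass e (p : pt) (A : set pt) : Prop :=
  pv p = orig e /\ A = [set q | pv q = orig e /\ edl e q = edl e p + fdist p q].

(** The same as [class_image], but into the bare set of points, on which the metric
    is not yet available. *)
Definition cimg (M : lmetric L0) (h : M -> pt) (E : ray_class M) (p : pt)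
    (A : set pt) : Prop :=
  exists a S, [/\ E a S, p = h a & A = h @` S].

Lemma cimg_eps t (f : edge Y) :
  cimg (cls (t * gE B f)%g) (eps D f) = xclass (ae t (lifte B f)).
Proof.
have [c hc] := edl_const t f; have [_ ->] := dlt_horo f.
have im a : cls (t * gE B f)%g @` hray (dlt D f) a =
    [set q | pv q = orig (ae t (lifte B f)) /\ edl (ae t (lifte B f)) q =
      edl (ae t (lifte B f)) (cls (t * gE B f)%g a) + fdist (cls (t * gE B f)%g a) q].
  rewrite orig_lift; apply/seteqP; split=> [_ [b hb <-]|q [/cls_at[b ->]]] /=.
    by split; rewrite ?pv_cls // !hc fdist_cls hb autpD addrAC.
  rewrite !hc fdist_cls addrAC => /addIr; rewrite -autpD => /autp_inj hb.
  by exists b.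
apply/funext => p; apply/funext => A; apply/propext; split.
  move=> [a [S [-> -> ->]]]; split; last exact: im.
  by rewrite pv_cls orig_lift.
case; rewrite {1}orig_lift => /cls_at[a ->] ->.
by exists a, (hray (dlt D f) a).
Qed.

Lemma cimgM (x : vert Y) g s (E : ray_class (trX D x)) :
  cimg (cls (g * inc x s)%g) E = cimg (cls g) (class_image (trA D x s) E).
Proof.
have im S : cls (g * inc x s)%g @` S = cls g @` (trA D x s @` S).
  apply/seteqP; split=> [_ [b Sb <-]|_ [_ [b Sb <-] <-]].
    by rewrite clsM; exists (trA D x s b) => //; exists b.
  by exists b; rewrite ?clsM.
apply/funext => p; apply/funext => A; apply/propext; split.
  move=> [a [S [ES -> ->]]]; exists (trA D x s a), (trA D x s @` S).
  by rewrite clsM im; split=> //; exists a, S.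
move=> [a [S [[b [S' [ES -> ->]]] -> ->]]]; exists b, S'.
by rewrite clsM im.
Qed.

Lemma cimg_existT (x1 x2 : vert Y) g
    (E1 : ray_class (trX D x1)) (E2 : ray_class (trX D x2)) : x1 = x2 ->
  cimg (cls g) E1 = cimg (cls g) E2 ->
  existT (fun x => ray_class (trX D x)) x1 E1 = existT _ x2 E2.
Proof.
move=> e; subst x2 => E.
have W (F1 F2 : ray_class (trX D x1)) a A :
    cimg (cls g) F1 = cimg (cls g) F2 -> F1 a A -> F2 a A.
  move=> EF h1; have : cimg (cls g) F1 (cls g a) (cls g @` A) by exists a, A.
  rewrite EF => -[b [S [h2 /cls_inj -> eA]]].
  suff -> : A = S by [].
  apply/seteqP; split=> c hc.
    have : (cls g @` S) (cls g c) by rewrite -eA; exists c.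
    by case=> d Sd /cls_inj <-.
  have : (cls g @` A) (cls g c) by rewrite eA; exists c.
  by case=> d Sd /cls_inj <-.
congr existT; apply/funext => a; apply/funext => A; apply/propext.
by split; apply: W.
Qed.

(** Distinct edges at a vertex have distinct ends: if they lie in different orbits,
    by [C2]; if they lie in the same orbit, because by [C1] the stabiliser of the
    end is the edge group. *)
Lemma edge_of_end t1 t2 (f1 f2 : edge Y) :
  orig (ae t1 (lifte B f1)) = orig (ae t2 (lifte B f2)) ->
  xclass (ae t1 (lifte B f1)) = xclass (ae t2 (lifte B f2)) ->
  ae t1 (lifte B f1) = ae t2 (lifte B f2).
Proof.
rewrite !orig_lift -!cimg_eps => ev.
have eo : orig f1 = orig f2.
  by rewrite -(quo_cls (orig f1) (t1 * gE B f1)%g) ev quo_cls.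
have [s es] : exists s : VG (orig f1),
    (t1 * gE B f1)%g = (t2 * gE B f2 * inc (orig f1) s)%g.
  by apply: stab_inc; rewrite ev eo.
rewrite es cimgM => /(cimg_existT eo) E.
have [e12|] := pselect (f1 = f2); last by move/c2 => /(_ s).
subst f2; move/(@Eqdep.EqdepTheory.inj_pair2 _ _ _ _ _): E => E.
have [_ /seteqP[_ /(_ s E)[r _ er]]] := c1 f1.
have -> : t1 = (t2 * (gE B f1 * inc (orig f1) (alpha f1 r) * (gE B f1)^-1))%g.
  by rewrite er !mulgA -es mulgK.
by rewrite aeM; congr ae; apply/stabeP; exists r.
Qed.

Lemma edl_sep e f v : e <> f -> orig e = v -> orig f = v ->
  exists z : treeat v, sep_at (fun a => edl e (chart a)) (fun a => edl f (chart a)) z.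
Proof.
move=> ne ev fv.
have [E|//] := horo_dichotomy (scale_mtree (theta (sec v)) (trX_mtree (quov v)))
  (edl_horo ev) (edl_horo fv).
case: ne; rewrite -(tauP e) -(tauP f); apply: edge_of_end; rewrite !tauP ?ev //.
apply/funext => p; apply/funext => A; rewrite /xclass ev fv.
have H (a b : treeat v) : edl e (chart b) = edl e (chart a) + fdist (chart a) (chart b)
    <-> edl f (chart b) = edl f (chart a) + fdist (chart a) (chart b).
  have /seteqP[h1 h2] := E a; rewrite fdist_chart.
  by split=> h; [exact: h1|exact: h2].
have ch q : pv q = v -> exists a : treeat v, chart a = q.
  by move=> <-; exact: chart_surj.
have S q : pv q = v -> [set r | pv r = v /\ edl e r = edl e q + fdist q r] =
    [set r | pv r = v /\ edl f r = edl f q + fdist q r].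
  by move=> /ch[a <-]; apply/seteqP; split=> r [hr hb]; split=> //;
    have [b eb] := ch _ hr; move: hb; rewrite -eb => /H.
by apply/propext; split=> -[h ->]; split=> //; rewrite S.
Qed.

(** ** The tree and its signature *)

Local Notation YT := (bs_is_tree B).
Local Notation td := (tdist YT pv fdist edl).

Let tree_mt v := scale_mtree (theta (sec v)) (trX_mtree (quov v)).
Let tree_inh v : inhabited (treeat v) := trX_inh (quov v).

Definition bstree : lmetric (lexZ L0) :=
  ttree YT tree_mt tree_inh pv_chart chart_surj fdist_chart edl_horo edl_sep.

Lemma bstree_mtree : mtree bstree.
Proof. exact: ttree_mtree. Qed.

Lemma bstree_ltree : is_ltree bstree.
Proof.
apply: mtree_ltree; first exact: bstree_mtree.
by have [v _] := YT.1; have [p _] := pt_over v; exists.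
Qed.

Lemma fdist_act g p q : pv p = pv q ->
  fdist (pact g p) (pact g q) = theta g (fdist p q).
Proof.
have [x [t [a ->]]] := pt_cls p; rewrite pv_cls => /esym/cls_at[b ->].
by rewrite !pact_cls !fdist_cls thetaE.
Qed.

Lemma linelen_act g kap e f : e <> f -> orig e = orig f ->
  (forall e p, pv p = orig e -> edl (ae g e) (pact g p) = theta g (edl e p) + kap e) ->
  linelen pv edl (ae g e) (ae g f) =
  theta g (linelen pv edl e f) - kap e - kap f.
Proof.
move=> ne eo hk; have [z hz] := edl_sep ne erefl (esym eo).
have hmax (y : pt) : pv y = orig e -> edl e y + edl f y <= edl e (chart z) + edl f (chart z).
  by move=> hy; move: (chart_surj y); rewrite hy => -[a <-]; exact: hz.
have pz : pv (chart z) = orig e by exact: pv_chart.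
rewrite (linelen_at pz hmax) (@linelen_at _ _ _ _ _ _ _ (pact g (chart z))).
- by rewrite !hk -?eo // autpN autpD; oag.
- by rewrite pv_pact pz act_orig.
move=> y; rewrite act_orig => hy.
have -> : y = pact g (pact g^-1%g y) by rewrite -pactM mulgV pact1.
have hy' : pv (pact g^-1%g y) = orig e by rewrite pv_pact hy -avM mulVg av1.
have := hmax _ hy'; rewrite -(autp_leE (theta g)) !autpD => h.
by rewrite !hk -?eo //; oag.
Qed.

(** Each edge of the path contributes the two constants of [edl_equiv] for its two
    orientations, whose sum is minus the translation part of [g]. *)
Lemma pathlen_act g kap v e p w : walk v (e :: p) w -> reduced (e :: p) ->
  (forall e p, pv p = orig e -> edl (ae g e) (pact g p) = theta g (edl e p) + kap e) ->
  (forall e, kap e + kap (erev e) = - mu g) ->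
  pathlen pv edl (ae g e) (map (ae g) p) - kap e - kap (erev (last e p)) =
  theta g (pathlen pv edl e p) + mu g *+ (size p).+1.
Proof.
move=> + + hk hs; elim: p v e => [|f p IH] v e.
  by move=> _ _ /=; rewrite autp0; have := hs e; oag.
move=> [_ hw] [hf hr]; have := IH _ _ hw hr.
have hw' : orig (erev e) = orig f by case: hw.
have := linelen_act (nesym hf) hw' hk; rewrite -act_rev /=.
rewrite autpD [in X in _ -> _ -> _ = X]mulrS; have := hs e.
by set A := mu g *+ (size p).+1; oag.
Qed.

Lemma td_act g p q : td (pact g p) (pact g q) = aff_lex (kaff g) (td p q).
Proof.
have hm := pth_map YT (pv p) (pv q) (@ae_inj g) (act_orig g) (act_rev g).
apply: lexP; rewrite /=; first by rewrite !pv_pact /nv hm size_map.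
rewrite /tdist2 !pv_pact hm /nv -/(theta g) -/(mu g).
have := pth_walk YT (pv p) (pv q); have := pth_red YT (pv p) (pv q).
case E: (pth YT (pv p) (pv q)) => [|e s] hr hw /=.
  by rewrite mulr0z addr0 fdist_act //; exact: pth_eq0 E.
have [kap [hk hs]] := edl_equiv g.
have he : pv p = orig e by rewrite (pth_orig E).
have hl : pv q = orig (erev (last e s)).
  elim: (s) (e) (pv p) hw {E hr he} => [|f s' IH] f0 v [_]; first by move=> <-.
  by move=> /IH.
have := pathlen_act hw hr hk hs; rewrite /taillen last_map act_rev !hk //.
by rewrite !autpD !autpN -pmulrn /=; move: (mu g *+ _) => A; oag.
Qed.

Lemma bstree_affine : is_affine (X := bstree) (fun g => aff_lex (kaff g)) pact.
Proof. by move=> g p q; exact: td_act. Qed.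

Lemma nv_pv p q : (@dist _ bstree p q).1 = (nv YT (pv p) (pv q))%:Z.
Proof. by []. Qed.

Lemma zpt_pv (p q : bstree) : zpt p = zpt q <-> pv p = pv q.
Proof.
rewrite zptP nv_pv; split=> [[/nv_eq0]//|->]; by rewrite nvxx.
Qed.

Definition over v : bstree := projT1 (cid (pt_over v)).
Lemma pv_over v : pv (over v) = v. Proof. by rewrite /over; case: cid. Qed.

Definition vmap v : ztensor bstree := zpt (over v).

Lemma zpt_vmap (p : bstree) v : zpt p = vmap v <-> pv p = v.
Proof. by rewrite zpt_pv pv_over. Qed.

Lemma vmap_adj e : zadj (vmap (orig e)) (vmap (orig (erev e))).
Proof.
exists (over (orig e)), (over (orig (erev e))); split=> //.
by rewrite nv_pv !pv_over /nv pth_edge.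
Qed.

Definition emap (e : edge (bsX B)) : edge (ztree bstree) :=
  exist _ (vmap (orig e), vmap (orig (erev e))) (vmap_adj e).

Lemma vmap_inj : injective vmap.
Proof. by move=> v w /zpt_vmap; rewrite pv_over. Qed.

Lemma vmap_bij : bijective vmap.
Proof.
apply: (inj_surj_bij (@vmap_inj)) => -[C hC]; have [p ep] := hC.
exists (pv p); have /zpt_vmap/esym -> : pv p = pv p by [].
by subst C; apply: eq_exist.
Qed.

Lemma edge_ends (e f : edge (bsX B)) :
  orig e = orig f -> orig (erev e) = orig (erev f) -> e = f.
Proof.
by move=> h1 h2; have := pth_edge YT e; rewrite h1 h2 pth_edge => -[].
Qed.

Lemma emap_bij : bijective emap.
Proof.
apply: inj_surj_bij => [e f|[[C1 C2] hC]].
  move=> /(congr1 sval) /= E; apply: edge_ends; apply: vmap_inj.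
    exact: (congr1 fst E).
  exact: (congr1 snd E).
have [p [q [/= ep eq h1]]] := hC.
have [/nv_eq1[e [_ e1 e2]]] : (nv YT (pv p) (pv q))%:Z = 1 by exact: h1.
exists e; apply: eq_exist; congr pair.
  by rewrite -ep; apply/esym/zpt_vmap.
by rewrite -eq; apply/esym/zpt_vmap.
Qed.

Lemma emap_rev e : emap (erev e) = zrev (emap e).
Proof. by apply: eq_exist; rewrite /= Defs.revK. Qed.

Definition ziso : graph_iso (bsX B) (ztree bstree) :=
  @GraphIso (bsX B) (ztree bstree) vmap emap vmap_bij emap_bij
    (fun _ => erefl) emap_rev.

Lemma zpt_cls1 x (a : trX D x) : zpt (cls 1%g a : bstree) = vmap (lift x).
Proof. by apply/zpt_vmap; rewrite pv_cls av1. Qed.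

Definition jmap x (a : trX D x) : fibre (ziso (lift x)) :=
  exist _ (cls 1%g a : bstree) (zpt_cls1 a).

Lemma zstabP v g : zstab (X := bstree) pact (vmap v) g <-> av g v = v.
Proof.
split=> [h|h p /zpt_vmap hp]; last by apply/zpt_vmap; rewrite pv_pact hp.
have /h/zpt_vmap : zpt (over v) = vmap v by [].
by rewrite pv_pact pv_over.
Qed.

Lemma jmap_bij x : bijective (@jmap x).
Proof.
apply: inj_surj_bij => [a b /(congr1 sval)|[p hp]]; first exact: cls_inj.
have /zpt_vmap hp' := hp.
have [|a ea] := @cls_at p x 1%g; first by rewrite hp' av1.
by exists a; apply: eq_exist; rewrite /= -ea.
Qed.

Lemma fibre_distP v (p q : fibre (vmap v)) :
  dist p q = fdist (fibre_val p) (fibre_val q).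
Proof.
have hp := (zpt_vmap _ _).1 (svalP p); have hq := (zpt_vmap _ _).1 (svalP q).
by rewrite /= /fibre_dist /= /tdist2 hp hq pth_nil.
Qed.

Lemma td_fib v (p q : pt) : pv p = v -> pv q = v -> td p q = inl0 (fdist p q).
Proof. by move=> hp hq; apply: tdist_fib; rewrite hp. Qed.

Lemma td_edge e (p q : pt) : pv p = orig e -> pv q = orig (erev e) ->
  td p q = (1, - edl e p - edl (erev e) q).
Proof.
move=> hp hq; rewrite /tdist /tdist2 /nv hp hq pth_edge /taillen /=.
by rewrite sub0r addrC.
Qed.

(** The end map at the far side of [e] cancels. *)
Lemma td_edge_btw e (p q r : pt) :
  pv p = orig e -> pv q = orig e -> pv r = orig (erev e) ->
  td p q + td q r = td p r <-> edl e q = edl e p + fdist p q.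
Proof.
move=> hp hq hr; rewrite (td_fib hp hq) (td_edge hq hr) (td_edge hp hr).
split=> [/(congr1 snd) /=|h]; first by oag.
by apply: lexP => /=; rewrite ?add0r // h; oag.
Qed.

(** Through this isometry the tree and end properties of the charts pass to the
    fibres over the quotient by Lambda_0-distances. *)
Lemma fibre_chart v : exists (f : fibre (vmap v) -> treeat v)
    (g : treeat v -> fibre (vmap v)),
  [/\ cancel f g, cancel g f, forall p, chart (f p) = fibre_val p &
      forall p q, dist p q = dist (f p) (f q)].
Proof.
have hg (a : treeat v) : zpt (chart a : bstree) = vmap v.
  by apply/zpt_vmap; exact: pv_chart.
pose g a : fibre (vmap v) := exist _ (chart a : bstree) (hg a).
have /choice[f fK] (p : fibre (vmap v)) : exists a, g a = p.
  case: p => p hp; have hp' := (zpt_vmap _ _).1 hp.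
  move: (chart_surj p); rewrite hp' => -[a ea].
  by exists a; apply: eq_exist.
have cf p : chart (f p) = fibre_val p by rewrite -{2}(fK p).
exists f, g; split=> // [a|p q].
  by apply: (@cls_inj (quov v) (sec v)); exact: (congr1 sval (fK (g a))).
by rewrite fibre_distP -!cf fdist_chart.
Qed.

Lemma fibre_mtree v : mtree (fibre (vmap v)).
Proof.
have [f [g [fK gK _ fd]]] := fibre_chart v; have [h1 h2 h3] := tree_mt v; split.
- move=> p q l; rewrite fd => /h1[z [z1 z2]].
  by exists (g z); rewrite !fd gK.
- by move=> p q r s; rewrite !fd; exact: h2.
move=> p q r; have [m [m1 m2 m3]] := h3 (f p) (f q) (f r).
by exists (g m); rewrite /btw !fd gK.
Qed.

Lemma fibre_horo e : horo (fun p : fibre (vmap (orig e)) => edl e (fibre_val p)).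
Proof.
have [f [g [fK gK cf fd]]] := fibre_chart (orig e).
have -> : (fun p : fibre (vmap (orig e)) => edl e (fibre_val p)) =
    (fun p => (1%g : autp L0) (edl e (chart (f p))) + 0).
  by apply/funext => p; rewrite addr0 cf.
exact: (@horo_transport _ _ _ 1%g 0 f g
  (fun a : treeat (orig e) => edl e (chart a)) fK gK fd (edl_horo erefl)).
Qed.

Lemma bstree_signature : has_signature B D theta mu (X := bstree) pact.
Proof.
exists idfun, ziso, jmap; split.
- move=> g [p [q [h1 /zpt_pv h2 /zpt_pv h3]]].
  have [/nv_eq1[e [_ e1 e2]]] : (nv YT (pv p) (pv q))%:Z = 1 by exact: h1.
  apply: (@act_noinv _ B g e); apply: edge_ends; rewrite ?Defs.revK.
    by rewrite act_orig e1 e2 -h2 pv_pact.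
  by rewrite act_rev act_orig e1 e2 -h3 pv_pact.
- by exists id.
- by move=> g v p /zpt_vmap hp; apply/zpt_vmap; rewrite pv_pact hp.
- move=> x; apply/seteqP; split=> g; rewrite /= => h.
    by have /stabvP := (zstabP _ _).1 h.
  by apply/zstabP/stabvP.
- move=> e; apply/seteqP; split=> g /=.
    move=> [/zstabP h1 /zstabP h2].
    have /stabeP[s ->] : ae g (lifte B e) = lifte B e.
      by apply: edge_ends; rewrite ?act_rev act_orig.
    by exists s.
  move=> [s _ <-]; set k := (_ / _)%g.
  have h : ae k (lifte B e) = lifte B e by apply/stabeP; exists s.
  by split; apply/zstabP; rewrite -act_orig -?act_rev h.
- exact: theta_inc.
- exact: mu_inc.
- exact: theta_gE.
- exact: mu_gE.
- exact: jmap_bij.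
- by move=> x a b; rewrite fibre_distP /= fdist_cls theta1.
- move=> x g a; change (cls 1%g (trA D x g a) = pact (inc x g) (cls 1%g a)).
  by rewrite pact_cls mulg1 -clsM mul1g.
- move=> e; pose e' := lifte B e.
  exists (hclass (fun p : fibre (vmap (orig e')) => edl e' (fibre_val p))); split.
  + apply: horo_is_end; [exact: fibre_mtree|exact: fibre_horo|].
    have h0 := (zpt_vmap _ _).2 (pv_over (orig e')); exact: (inhabits (exist _ (over (orig e')) h0)).
  + move=> x y; rewrite ray_to_hclass (mtree_in_seg bstree_mtree).
    have hx : pv (fibre_val x) = orig e' := (zpt_vmap _ _).1 (svalP x).
    have hy : pv (fibre_val y) = orig (erev e') := (zpt_vmap _ _).1 (svalP y).
    have H (p : fibre (vmap (orig e'))) :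
        btw (fibre_val x) (fibre_val p) (fibre_val y) <->
        beyond (fun p : fibre (vmap (orig e')) => edl e' (fibre_val p)) x p.
      have hp : pv (fibre_val p) = orig e' := (zpt_vmap _ _).1 (svalP p).
      by rewrite /beyond fibre_distP; exact: td_edge_btw hx hp hy.
    apply/seteqP; split=> [q [hb [p _ ep]]|_ [p /H hb <-]]; last first.
      by split=> //; exists p.
    by exists p => //; apply/H; rewrite ep.
  have := cimg_eps (gE B e)^-1%g e; rewrite mulVg.
  have [kap [hk _]] := edl_equiv (gE B e)^-1%g.
  set k := (gE B e)^-1%g in hk * => E.
  (* both sides are the end of the edge e', carried by k to the tree over the
     lift of the origin of e *)
  transitivity (xclass (ae k e')); first exact: E.
  have im (p : fibre (vmap (orig e'))) :
      (fun p : fibre (vmap (orig e')) => pact k (fibre_val p)) @`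
        hray (fun p : fibre (vmap (orig e')) => edl e' (fibre_val p)) p =
      [set q | pv q = orig (ae k e') /\
        edl (ae k e') q = edl (ae k e') (pact k (fibre_val p)) +
                          fdist (pact k (fibre_val p)) q].
    have hp := (zpt_vmap _ _).1 (svalP p).
    apply/seteqP; split=> [_ [q hq <-]|q [hq]] /=.
      have hq' := (zpt_vmap _ _).1 (svalP q).
      split; first by rewrite pv_pact hq' act_orig.
      rewrite !hk // fdist_act ?hp //.
      by move: hq; rewrite /hray /= /beyond fibre_distP => ->; rewrite autpD addrAC.
    have hz : zpt (pact k^-1%g q : bstree) = vmap (orig e').
      by apply/zpt_vmap; rewrite pv_pact hq act_orig -avM mulVg av1.
    have eq : q = pact k (pact k^-1%g q) by rewrite -pactM mulgV pact1.
    have hz' := (zpt_vmap _ _).1 hz.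
    rewrite eq !hk // fdist_act ?hp // addrAC => /addIr.
    rewrite -autpD => /autp_inj h.
    exists (exist _ (pact k^-1%g q : bstree) hz) => //.
    by rewrite /hray /= /beyond fibre_distP.
  apply/funext => p; apply/funext => A; apply/propext; split.
    move=> [hp ->].
    have hz : zpt (pact k^-1%g p : bstree) = vmap (orig e').
      by apply/zpt_vmap; rewrite pv_pact hp act_orig -avM mulVg av1.
    pose z : fibre (vmap (orig e')) := exist _ (pact k^-1%g p : bstree) hz.
    have ez : pact k (fibre_val z) = p by rewrite /= -pactM mulgV pact1.
    exists z, (hray (fun p : fibre (vmap (orig e')) => edl e' (fibre_val p)) z).
    by split=> //; rewrite im ez.
  move=> [z [S [-> -> ->]]]; split; last exact: im.
  by rewrite pv_pact ((zpt_vmap _ _).1 (svalP z)) act_orig.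
move=> e x y a b ea eb.
have ex : fibre_val x = cls (gE B e) a.
  rewrite -[fibre_val x]pact1 -(mulgV (gE B e)) pactM.
  rewrite -[pact _^-1%g _]ea -[fibre_val (jmap a)]/(cls 1%g a).
  by rewrite pact_cls mulg1.
have ey : fibre_val y = cls (gE B (erev e)) b.
  rewrite -[fibre_val y]pact1 -(mulgV (gE B (erev e))) pactM.
  rewrite -[pact _^-1%g _]eb -[fibre_val (jmap b)]/(cls 1%g b).
  by rewrite pact_cls mulg1.
have hx := (zpt_vmap _ _).1 (svalP x); have hy := (zpt_vmap _ _).1 (svalP y).
rewrite /= (td_edge hx hy); congr pair.
have := edl_sum 1%g a b; rewrite !mul1g ae1 theta1 autp_oneE -ex -ey.
have -> : mu 1%g = 0 by rewrite /mu mult1.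
by rewrite subr0 -!opprD => ->.
Qed.

End Model.

Theorem theorem2p3 (L0 : oagType) (GG : graph_of_groups) (B : bass_serre GG)
    (D : sig_data L0 GG) :
  C1 D -> C2 D -> C3 B D -> C4 B D -> C5 B D ->
  exists (Gam : groupType) (beta : {multiplicative Gam -> (autp (lexZ L0))})
      (theta : Gam -> autp L0) (mu : Gam -> L0)
      (X : lmetric (lexZ L0)) (act : Gam -> X -> X),
    [/\ forall (g : Gam) (l : L0),
          beta g ((1, l) : lexZ L0) = (1, theta g l + mu g) :> lexZ L0,
        is_ltree X,
        is_action act,
        is_affine beta act &
        has_signature B D theta mu act].
Proof.
move=> c1 c2 c3 c4 c5.
exists (pi1 B), (@aff_lex L0 \o kaff c3 c4), (theta c3 c4), (mu c3 c4).
exists (bstree c1 c2 c3 c4 c5), (@pact _ _ B D); split.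
- by move=> g l; apply: lexP.
- exact: bstree_ltree.
- exact: pact_action.
- exact: bstree_affine.
exact: bstree_signature.
Qed.
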